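(* Let $a:\mathbb{C}\to\mathbb{C}$ be an entire holomorphic function with $a(w)\neq 0$ for every $w\in\mathbb{C}$. Let $c=\alpha+i\beta\in\mathbb{C}\setminus\{0,1,-1\}$ with $\alpha^2+\beta^2\neq 1$, put $b(w)=c/a(w)$, and let $X_0\in\mathbb{R}^4$. Define, for $w=u+iv\in\mathbb{C}$, $$f(w)=X_0+2\,\mathrm{Re}\int_0^w\Big(a(\xi)+\frac{c}{a(\xi)},\;1+c,\;i(1-c),\;a(\xi)-\frac{c}{a(\xi)}\Big)\,d\xi .$$ Then $f$ is a conformal (isothermic) minimal spacelike immersion of $\mathbb{C}$ into $\mathbb{R}^4_1$ (with $f_w=W(a,b)$, i.e. $\mu\equiv 1$). The coordinates $x=f^1-X_0^1=2[(1+\alpha)u-\beta v]$, $y=f^2-X_0^2=2[\beta u+(\alpha-1)v]$ define a linear bijection $(u,v)\mapsto(x,y)$ of $\mathbb{R}^2$ (equivalently $x_w=1+c$, $y_w=i(1-c)$), so that $f(\mathbb{C})$ is an entire graph of first type, i.e. $f(\mathbb{C})=\{(A(x,y),\,x+X_0^1,\,y+X_0^2,\,B(x,y)):(x,y)\in\mathbb{R}^2\}$ for smooth real functions $A,B$ on $\mathbb{R}^2$. Moreover, if $a$ is not constant, then there is a point of the surface at which the Gauss curvature is nonzero, and $f(\mathbb{C})$ is not contained in any affine hyperplane of $\mathbb{R}^4_1$.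
   Context: $\mathbb{R}^4_1$ is $\mathbb{R}^4$ with the Lorentzian product $\langle (a_0,a_1,a_2,a_3),(b_0,b_1,b_2,b_3)\rangle=-a_0b_0+a_1b_1+a_2b_2+a_3b_3$, extended complex-bilinearly to $\mathbb{C}^4$. A surface is spacelike if its induced metric is positive definite. For a map $f$ of a domain of $\mathbb{C}$ with parameter $w=u+iv$, $f_w=\tfrac12(f_u-if_v)$; $f$ is conformal (isothermic) if $\langle f_w,f_w\rangle=0$ and $\langle f_w,\overline{f_w}\rangle=\lambda^2/2>0$, in which case the induced metric is $\lambda^2|dw|^2$ and the Gauss curvature is $K=-\lambda^{-2}\Delta\ln\lambda$ with $\Delta=\partial_u^2+\partial_v^2$. For complex functions $a,b$ put $W(a,b)=(a+b,\,1+ab,\,i(1-ab),\,a-b)$. A surface is minimal if its mean curvature vector vanishes, equivalently each coordinate function is harmonic for the induced metric. A graph of first type is a surface $\{(A(x,y),x,y,B(x,y))\}$. *)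

(* Defs.v *)
From Stdlib Require Import Reals.
From Coquelicot Require Import Coquelicot.

Open Scope R_scope.

(* A point/vector of R^4 (resp. C^4) is given by its coordinates k = 0,1,2,3;
   values at k >= 4 are irrelevant and never used. *)

Definition entire (a : C -> C) : Prop := forall z : C, ex_derive a z.

Definition lorC (p q : nat -> C) : C :=
  (- (p 0%nat * q 0%nat) + p 1%nat * q 1%nat + p 2%nat * q 2%nat
   + p 3%nat * q 3%nat)%C.
Definition lorR (p q : nat -> R) : R :=
  - (p 0%nat * q 0%nat) + p 1%nat * q 1%nat + p 2%nat * q 2%nat
  + p 3%nat * q 3%nat.

Definition Wv (a b : C) (k : nat) : C :=
  match k with
  | 0%nat => (a + b)%C
  | 1%nat => (1 + a * b)%C
  | 2%nat => (Ci * (1 - a * b))%C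
  | _ => (a - b)%C
  end.

Definition integrand (a : C -> C) (c : C) (xi : C) (k : nat) : C :=
  match k with
  | 0%nat => (a xi + c / a xi)%C
  | 1%nat => (1 + c)%C
  | 2%nat => (Ci * (1 - c))%C
  | _ => (a xi - c / a xi)%C
  end.

(* f(w) = X0 + 2 Re \int_0^w integrand(xi) dxi, the complex line integral
   taken along the segment [0,w] (xi = t w, dxi = w dt, t in [0,1]);
   the real part is taken inside the (real) Riemann integral. *)
Definition fsurf (a : C -> C) (c : C) (X0 : nat -> R) (k : nat) (u v : R) : R :=
  X0 k + 2 * RInt (fun t : R =>
                     Re (integrand a c (RtoC t * (u, v))%C k * (u, v))%C) 0 1.

Definition du (h : R -> R -> R) (u v : R) : R := Derive (fun s => h s v) u.
Definition dv (h : R -> R -> R) (u v : R) : R := Derive (fun s => h u s) v.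

Fixpoint dpart (s : list bool) (h : R -> R -> R) : R -> R -> R :=
  match s with
  | nil => h
  | cons b s' => if b then du (dpart s' h) else dv (dpart s' h)
  end.

Definition smooth2 (h : R -> R -> R) : Prop :=
  forall (s : list bool) (u v : R),
    ex_derive (fun t => dpart s h t v) u /\
    ex_derive (fun t => dpart s h u t) v /\
    continuous (fun p : R * R => dpart s h (fst p) (snd p)) (u, v).

Definition Fu (F : nat -> R -> R -> R) (u v : R) : nat -> R :=
  fun k => du (F k) u v.
Definition Fv (F : nat -> R -> R -> R) (u v : R) : nat -> R :=
  fun k => dv (F k) u v.

Definition fw (F : nat -> R -> R -> R) (u v : R) : nat -> C :=
  fun k => (du (F k) u v / 2, - (dv (F k) u v) / 2).

Definition conjv (p : nat -> C) : nat -> C := fun k => Cconj (p k).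

Definition immersion (F : nat -> R -> R -> R) : Prop :=
  (forall k, (k < 4)%nat -> smooth2 (F k)) /\
  forall u v s t : R,
    (forall k, (k < 4)%nat -> s * du (F k) u v + t * dv (F k) u v = 0) ->
    s = 0 /\ t = 0.

Definition g11 F u v := lorR (Fu F u v) (Fu F u v).
Definition g12 F u v := lorR (Fu F u v) (Fv F u v).
Definition g22 F u v := lorR (Fv F u v) (Fv F u v).
Definition gdet F u v := g11 F u v * g22 F u v - g12 F u v ^ 2.

Definition spacelike (F : nat -> R -> R -> R) : Prop :=
  forall u v, 0 < g11 F u v /\ 0 < gdet F u v.

Definition conformal (F : nat -> R -> R -> R) : Prop :=
  forall u v,
    lorC (fw F u v) (fw F u v) = RtoC 0 /\
    Im (lorC (fw F u v) (conjv (fw F u v))) = 0 /\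
    0 < Re (lorC (fw F u v) (conjv (fw F u v))).

(* Laplace-Beltrami operator of the induced metric:
   (1/sqrt D) [ d_u( sqrt D (g^11 h_u + g^12 h_v) ) + d_v( sqrt D (g^21 h_u + g^22 h_v) ) ] *)
Definition laplace_beltrami (F : nat -> R -> R -> R) (h : R -> R -> R) (u v : R) : R :=
  / sqrt (gdet F u v) *
  ( du (fun u' v' => sqrt (gdet F u' v') *
          ((g22 F u' v' / gdet F u' v') * du h u' v'
           - (g12 F u' v' / gdet F u' v') * dv h u' v')) u v
  + dv (fun u' v' => sqrt (gdet F u' v') *
          (- (g12 F u' v' / gdet F u' v') * du h u' v'
           + (g11 F u' v' / gdet F u' v') * dv h u' v')) u v ).

Definition minimal (F : nat -> R -> R -> R) : Prop :=
  forall k u v, (k < 4)%nat -> laplace_beltrami F (F k) u v = 0.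

Definition lap (h : R -> R -> R) (u v : R) : R :=
  du (du h) u v + dv (dv h) u v.

Definition lam2 (F : nat -> R -> R -> R) (u v : R) : R :=
  2 * Re (lorC (fw F u v) (conjv (fw F u v))).

(* Gauss curvature in conformal coordinates: K = - lambda^-2 Delta ln lambda *)
Definition gauss_curv (F : nat -> R -> R -> R) (u v : R) : R :=
  - / lam2 F u v * lap (fun u' v' => ln (lam2 F u' v') / 2) u v.

Definition entire_graph_first_type (F : nat -> R -> R -> R) (X0 : nat -> R) : Prop :=
  exists A B : R -> R -> R,
    smooth2 A /\ smooth2 B /\
    (forall u v, exists x y,
        F 0%nat u v = A x y /\ F 1%nat u v = x + X0 1%nat /\
        F 2%nat u v = y + X0 2%nat /\ F 3%nat u v = B x y) /\
    (forall x y, exists u v,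
        F 0%nat u v = A x y /\ F 1%nat u v = x + X0 1%nat /\
        F 2%nat u v = y + X0 2%nat /\ F 3%nat u v = B x y).

Definition not_in_hyperplane (F : nat -> R -> R -> R) : Prop :=
  forall (n : nat -> R) (d : R),
    (exists k, (k < 4)%nat /\ n k <> 0) ->
    exists u v, n 0%nat * F 0%nat u v + n 1%nat * F 1%nat u v
                + n 2%nat * F 2%nat u v + n 3%nat * F 3%nat u v <> d.

(* Main.v *)
(* The integrand is holomorphic, so each coordinate of [f] is the real part of a
   holomorphic function: that gives smoothness, [f_w = W(a, c/a)] and harmonicity,
   and conformality is the algebraic identity [<W, W> = 0].  Complex
   differentiability alone is assumed, so primitives come from Goursat's bisection
   of triangles; the primitive [F] of [a] makes [(F w - F z) / (w - z)] entire in
   [w], hence Cauchy's formula for [F] follows by integrating over a circle, and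
   differentiating it under the integral sign shows that [a'] is again entire.

   The conformal factor is [lambda^2 = 4 |1 - a conj(c/a)|^2], positive because
   [|a conj(c/a)| = |c| <> 1].  With [a = p + i q] it equals [4 S(p,q) / (p^2+q^2)]
   for a quadratic form [S], and [Delta ln lambda = 4 |a'|^2 T(p,q) / S(p,q)^2] for a
   second quadratic form [T], which is nondegenerate as [|c|] is neither 0 nor 1.
   If the curvature vanished identically, [T] would vanish on the open set
   [a {a' <> 0}], hence so would its gradient, forcing [a = 0].

   A hyperplane containing the surface gives a quadratic equation with constant
   coefficients satisfied by [a]; differentiating it kills the coefficients. *)

Require Import Defs.
From Stdlib Require Import Reals Lra Lia Classical ClassicalEpsilon.
From Coquelicot Require Import Coquelicot.
Open Scope R_scope.

(** * Complex differentiability and its real differential *)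

Local Notation ccont := (continuous (U := C_UniformSpace)).

(** Cleared of denominators, so that [h = 0] is harmless and no punctured neighbourhood appears;
    both sides are measured by [Cmod]. *)
Definition cderiv (f : C -> C) (z l : C) : Prop :=
  forall eps, 0 < eps -> exists delta, 0 < delta /\
    forall h, Cmod h < delta -> Cmod (f (z + h) - f z - l * h)%C <= eps * Cmod h.

(* [C_NormedModule] carries the sup-norm balls of [R * R], whereas the normed module
   of the absolute-value ring [C_AbsRing] carries the balls of [Cmod]; the two are not
   convertible, whence this variant of [cderiv_iff]. *)
Lemma is_derive_cderiv (f : C -> C) (z l : C) :
  is_derive (K := C_AbsRing) (V := C_NormedModule) f z l -> cderiv f z l.
Proof.
intros [_ H] eps Heps.
destruct (H z (fun P HP => HP) (mkposreal eps Heps)) as [d Hd].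
exists d; split; [apply cond_pos|]; intros h Hh.
assert (E : forall w : C, (z + h - z = h)%C) by (intros; ring).
specialize (Hd (z + h)%C).
assert (B : Cmod (z + h - z)%C < d) by now rewrite E.
specialize (Hd B).
change (Cmod ((f (z + h) - f z) - (z + h - z) * l)%C <= eps * Cmod (z + h - z)%C) in Hd.
rewrite E in Hd; auto.
now rewrite (Cmult_comm l h).
Qed.

Lemma Cmod_le_sum (z : C) : Cmod z <= Rabs (Re z) + Rabs (Im z).
Proof.
destruct z as [x y]; unfold Re, Im; simpl.
replace (x, y) with (RtoC x + Ci * RtoC y)%C.
2: { unfold RtoC, Ci, Cplus, Cmult; simpl; f_equal; ring. }
eapply Rle_trans; [apply Cmod_triangle|].
rewrite Cmod_mult, Cmod_Ci, !Cmod_R; lra.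
Qed.

Lemma im_le_Cmod (z : C) : Rabs (Im z) <= Cmod z.
Proof. eapply Rle_trans; [apply Rmax_r|apply (Rmax_Cmod z)]. Qed.

Lemma Cmod_minus_sym (z w : C) : Cmod (z - w) = Cmod (w - z).
Proof. rewrite <- Cmod_opp; f_equal; ring. Qed.

(** Multiplication by [l] is the real matrix with rows [(Re l, - Im l)] and [(Im l, Re l)]: these
    are the Cauchy-Riemann equations. *)
Lemma cderiv_2d (f : C -> C) (x y : R) (l : C) :
  cderiv f (x, y) l ->
  differentiable_pt_lim (fun u v => Re (f (u, v))) x y (Re l) (- Im l) /\
  differentiable_pt_lim (fun u v => Im (f (u, v))) x y (Im l) (Re l).
Proof.
intros H.
assert (K : forall eps : posreal, locally_2d (fun u v =>
   Cmod (f (u, v) - f (x, y) - l * ((u - x)%R, (v - y)%R))%C <=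
     eps * Rmax (Rabs (u - x)) (Rabs (v - y))) x y).
{ intros eps.
  (* The half absorbs the bound of [Cmod] by twice the maximum norm. *)
  destruct (H (eps / 2)) as [d [Hd K]]; [destruct eps; simpl; lra|].
  assert (Hd2 : 0 < d / 2) by lra.
  exists (mkposreal _ Hd2); simpl; intros u v Hu Hv.
  assert (B : Cmod ((u - x)%R, (v - y)%R) <= 2 * Rmax (Rabs (u - x)) (Rabs (v - y))).
  { eapply Rle_trans; [apply Cmod_le_sum|]; simpl.
    generalize (Rmax_l (Rabs (u - x)) (Rabs (v - y))) (Rmax_r (Rabs (u - x)) (Rabs (v - y))); lra. }
  specialize (K ((u - x)%R, (v - y)%R)).
  replace ((x, y) + ((u - x)%R, (v - y)%R))%C with ((u, v) : C) in K
    by (unfold Cplus; simpl; f_equal; ring).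
  eapply Rle_trans; [apply K|].
  - eapply Rle_lt_trans; [apply Cmod_le_sum|]; simpl; lra.
  - destruct eps as [e He]; simpl.
    replace (e * Rmax (Rabs (u - x)) (Rabs (v - y)))
      with (e / 2 * (2 * Rmax (Rabs (u - x)) (Rabs (v - y)))) by field.
    apply Rmult_le_compat_l; lra. }
split; intros eps; destruct (K eps) as [d Hd]; exists d; intros u v Hu Hv;
  specialize (Hd u v Hu Hv); (eapply Rle_trans; [|exact Hd]).
- eapply Rle_trans; [|apply re_le_Cmod]. right; f_equal.
  unfold Cminus; rewrite !re_plus, !re_opp, re_mult; simpl; ring.
- eapply Rle_trans; [|apply im_le_Cmod]. right; f_equal.
  unfold Cminus; rewrite !im_plus, !im_opp, im_mult; simpl; ring.
Qed.

(** Chain rule through the real differential; it carries the one-variable fundamental theorem of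
    calculus over to line integrals. *)
Lemma cderiv_curve (f : C -> C) (x y : R -> R) (t dx dy : R) (l : C) :
  cderiv f (x t, y t) l -> is_derive x t dx -> is_derive y t dy ->
  is_derive (fun s => Re (f (x s, y s))) t (Re (l * (dx, dy))%C) /\
  is_derive (fun s => Im (f (x s, y s))) t (Im (l * (dx, dy))%C).
Proof.
intros H Hx Hy; destruct (cderiv_2d _ _ _ _ H) as [H1 H2].
apply is_derive_Reals in Hx; apply is_derive_Reals in Hy.
split; apply is_derive_Reals.
- replace (Re (l * (dx, dy))%C) with (Re l * dx + - Im l * dy)
    by (rewrite re_mult; simpl; ring).
  exact (derivable_pt_lim_comp_2d (fun u v => Re (f (u, v))) x y t _ _ _ _ H1 Hx Hy).
- replace (Im (l * (dx, dy))%C) with (Im l * dx + Re l * dy)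
    by (rewrite im_mult; simpl; ring).
  exact (derivable_pt_lim_comp_2d (fun u v => Im (f (u, v))) x y t _ _ _ _ H2 Hx Hy).
Qed.

(** * Continuity of complex-valued functions *)

Lemma continuous_pair {U : UniformSpace} (f : U -> C) (t : U) :
  continuous (fun s => Re (f s)) t -> continuous (fun s => Im (f s)) t ->
  ccont f t.
Proof.
intros H1 H2.
apply (continuous_ext (fun s => (Re (f s), Im (f s)) : C_UniformSpace)).
{ intros s; now destruct (f s). }
apply (continuous_comp_2 (W := R_UniformSpace) (X := C_UniformSpace)
        (fun s => Re (f s)) (fun s => Im (f s)) (fun u v => (u, v)) t H1 H2).
apply (continuous_ext (fun p => p)); [now intros [? ?]|apply continuous_id].
Qed.

Lemma continuous_Re {U : UniformSpace} (f : U -> C) (t : U) :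
  ccont f t -> continuous (fun s => Re (f s)) t.
Proof.
intros H; apply (continuous_comp (V := C_UniformSpace) f Re t H).
destruct (f t); apply continuous_fst.
Qed.

Lemma continuous_Im {U : UniformSpace} (f : U -> C) (t : U) :
  ccont f t -> continuous (fun s => Im (f s)) t.
Proof.
intros H; apply (continuous_comp (V := C_UniformSpace) f Im t H).
destruct (f t); apply continuous_snd.
Qed.

Lemma continuous_Cplus {U : UniformSpace} (f g : U -> C) (t : U) :
  ccont f t -> ccont g t ->
  ccont (fun s => f s + g s)%C t.
Proof.
intros Hf Hg; apply continuous_pair; simpl.
- apply (continuous_plus (V := R_NormedModule)); now apply continuous_Re.
- apply (continuous_plus (V := R_NormedModule)); now apply continuous_Im.
Qed.

Lemma continuous_Rmult {U : UniformSpace} (f g : U -> R) (t : U) :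
  continuous f t -> continuous g t -> continuous (fun s => f s * g s) t.
Proof. exact (continuous_mult (K := R_AbsRing) f g t). Qed.

Lemma continuous_Cmult {U : UniformSpace} (f g : U -> C) (t : U) :
  ccont f t -> ccont g t ->
  ccont (fun s => f s * g s)%C t.
Proof.
intros Hf Hg.
assert (F1 := continuous_Re _ _ Hf); assert (F2 := continuous_Im _ _ Hf).
assert (G1 := continuous_Re _ _ Hg); assert (G2 := continuous_Im _ _ Hg).
apply continuous_pair.
- exact (continuous_minus (V := R_NormedModule) _ _ t
    (continuous_Rmult _ _ t F1 G1) (continuous_Rmult _ _ t F2 G2)).
- exact (continuous_plus (V := R_NormedModule) _ _ t
    (continuous_Rmult _ _ t F1 G2) (continuous_Rmult _ _ t F2 G1)).
Qed.

Lemma continuous_Cinv {U : UniformSpace} (f : U -> C) (t : U) :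
  ccont f t -> f t <> RtoC 0 ->
  ccont (fun s => / f s)%C t.
Proof.
intros Hf H0.
assert (H1 := continuous_Re _ _ Hf). assert (H2 := continuous_Im _ _ Hf).
assert (N : continuous (fun s => / (Re (f s) ^ 2 + Im (f s) ^ 2)) t).
{ apply (continuous_comp (fun s => Re (f s) ^ 2 + Im (f s) ^ 2) Rinv);
    [|apply continuous_Rinv].
  - apply (continuous_ext (fun s => Re (f s) * Re (f s) + Im (f s) * Im (f s))).
    { intros s; simpl; now rewrite !Rmult_1_r. }
    exact (continuous_plus (V := R_NormedModule) _ _ t
      (continuous_Rmult _ _ t H1 H1) (continuous_Rmult _ _ t H2 H2)).
  - rewrite <- Cmod2_alt; apply pow_nonzero.
    now apply Rgt_not_eq, Cmod_gt_0. }
apply continuous_pair.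
- exact (continuous_Rmult _ _ t H1 N).
- exact (continuous_Rmult _ _ t (continuous_opp (V := R_NormedModule) _ t H2) N).
Qed.

(** The uniform structure of [C] has square balls, [Cmod] has discs: a disc lies in the square of
    the same radius, and the square of half the radius lies in the disc. *)
Lemma continuous_C_eps (f : C -> C) (z : C) :
  ccont f z <->
  forall eps, 0 < eps -> exists delta, 0 < delta /\
    forall w, Cmod (w - z) < delta -> Cmod (f w - f z) < eps.
Proof.
split.
- intros H eps Heps.
  assert (He : 0 < eps / 2) by lra.
  destruct (proj1 (filterlim_locally f (f z)) H (mkposreal _ He)) as [d Hd].
  exists d; split; [apply cond_pos|]; intros w Hw.
  destruct (Hd w) as [B1 B2].
  + split; (eapply Rle_lt_trans; [|exact Hw]).
    * apply (re_le_Cmod (w - z)). * apply (im_le_Cmod (w - z)).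
  + change (Rabs (Re (f w) - Re (f z)) < eps / 2) in B1.
    change (Rabs (Im (f w) - Im (f z)) < eps / 2) in B2.
    eapply Rle_lt_trans; [apply Cmod_le_sum|]; simpl.
    unfold Re, Im in *; unfold Rminus in *; lra.
- intros H; apply filterlim_locally; intros eps.
  destruct (H eps (cond_pos eps)) as [d [Hd K]].
  assert (Hd2 : 0 < d / 2) by lra.
  exists (mkposreal _ Hd2); intros w [B1 B2]; simpl in B1, B2.
  assert (L : Cmod (f w - f z) < eps).
  { apply K; eapply Rle_lt_trans; [apply Cmod_le_sum|].
    change (Rabs (Re w - Re z) < d / 2) in B1; change (Rabs (Im w - Im z) < d / 2) in B2.
    change (Rabs (Re w - Re z) + Rabs (Im w - Im z) < d); lra. }
  split; (eapply Rle_lt_trans; [|exact L]).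
  + apply (re_le_Cmod (f w - f z)). + apply (im_le_Cmod (f w - f z)).
Qed.

Lemma cderiv_continuous (f : C -> C) (z l : C) :
  cderiv f z l -> ccont f z.
Proof.
intros H; apply continuous_C_eps; intros eps Heps.
destruct (H 1 Rlt_0_1) as [d [Hd K]].
assert (L := Cmod_ge_0 l).
exists (Rmin d (eps / (2 + Cmod l))); split.
{ apply Rmin_pos; auto; apply Rdiv_lt_0_compat; lra. }
intros w Hw.
assert (H1 : Cmod (w - z) < d) by (eapply Rlt_le_trans; [exact Hw|apply Rmin_l]).
assert (H2 : Cmod (w - z) < eps / (2 + Cmod l)) by (eapply Rlt_le_trans; [exact Hw|apply Rmin_r]).
specialize (K _ H1). replace (z + (w - z))%C with w in K by ring.
replace (f w - f z)%C with ((f w - f z - l * (w - z)) + l * (w - z))%C by ring.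
eapply Rle_lt_trans; [apply Cmod_triangle|]. rewrite Cmod_mult.
apply Rle_lt_trans with ((2 + Cmod l) * Cmod (w - z)).
{ generalize (Cmod_ge_0 (w - z)); nra. }
apply Rmult_lt_compat_l with (r := 2 + Cmod l) in H2; [|lra].
replace ((2 + Cmod l) * (eps / (2 + Cmod l))) with eps in H2 by (field; lra). lra.
Qed.

(** * Integrals of complex-valued functions *)

Definition is_CInt (f : R -> C) (a b : R) (I : C) : Prop :=
  is_RInt (fun t => Re (f t)) a b (Re I) /\ is_RInt (fun t => Im (f t)) a b (Im I).

Definition CInt (f : R -> C) (a b : R) : C :=
  (RInt (fun t => Re (f t)) a b, RInt (fun t => Im (f t)) a b).

Lemma is_CInt_unique f a b I : is_CInt f a b I -> CInt f a b = I.
Proof.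
intros [H1 H2]; unfold CInt.
rewrite (is_RInt_unique _ _ _ _ H1), (is_RInt_unique _ _ _ _ H2).
now destruct I.
Qed.

Lemma CInt_correct (f : R -> C) a b :
  (forall t, Rmin a b <= t <= Rmax a b -> ccont f t) -> is_CInt f a b (CInt f a b).
Proof.
intros H; split; apply (RInt_correct (V := R_CompleteNormedModule));
apply (ex_RInt_continuous (V := R_CompleteNormedModule)); intros t Ht.
- now apply continuous_Re, H.
- now apply continuous_Im, H.
Qed.

Lemma is_CInt_ext (f g : R -> C) a b I :
  (forall t, Rmin a b < t < Rmax a b -> f t = g t) -> is_CInt f a b I -> is_CInt g a b I.
Proof.
intros E [H1 H2]; split; (eapply is_RInt_ext; [|eassumption]);
intros t Ht; simpl; now rewrite E.
Qed.

Lemma is_CInt_plus f g a b I J :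
  is_CInt f a b I -> is_CInt g a b J -> is_CInt (fun t => f t + g t)%C a b (I + J)%C.
Proof.
intros [H1 H2] [H3 H4]; split; simpl; now apply (is_RInt_plus (V := R_NormedModule)).
Qed.

Lemma is_CInt_scal (c : C) f a b I :
  is_CInt f a b I -> is_CInt (fun t => c * f t)%C a b (c * I)%C.
Proof.
intros [H1 H2]; split; simpl.
- apply (is_RInt_minus (V := R_NormedModule)); now apply (is_RInt_scal (V := R_NormedModule)).
- apply (is_RInt_plus (V := R_NormedModule)); now apply (is_RInt_scal (V := R_NormedModule)).
Qed.

Lemma is_CInt_minus f g a b I J :
  is_CInt f a b I -> is_CInt g a b J -> is_CInt (fun t => f t - g t)%C a b (I - J)%C.
Proof.
intros [H1 H2] [H3 H4]; split; simpl; now apply (is_RInt_minus (V := R_NormedModule)).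
Qed.

Lemma is_CInt_Chasles f a b c I J :
  is_CInt f a b I -> is_CInt f b c J -> is_CInt f a c (I + J)%C.
Proof.
intros [H1 H2] [H3 H4]; split; simpl; eapply (is_RInt_Chasles (V := R_NormedModule)); eauto.
Qed.

Lemma is_CInt_comp_lin f (u v a b : R) I :
  is_CInt f (u * a + v) (u * b + v) I ->
  is_CInt (fun t => RtoC u * f (u * t + v)%R)%C a b I.
Proof.
intros [H1 H2]; split.
- generalize (is_RInt_comp_lin (V := R_NormedModule) _ _ _ _ _ _ H1); apply is_RInt_ext.
  intros t _; rewrite re_scal_l; reflexivity.
- generalize (is_RInt_comp_lin (V := R_NormedModule) _ _ _ _ _ _ H2); apply is_RInt_ext.
  intros t _; rewrite im_scal_l; reflexivity.
Qed.

(* The factor 2 comes from bounding the real and imaginary parts separately. *)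
Lemma is_CInt_bound f (a b : R) I (M : R) :
  a <= b -> (forall t, a <= t <= b -> Cmod (f t) <= M) -> is_CInt f a b I ->
  Cmod I <= 2 * M * (b - a).
Proof.
intros Hab HM [H1 H2].
assert (B1 : Rabs (Re I) <= (b - a) * M).
{ apply (norm_RInt_le_const (V := R_NormedModule) (fun t => Re (f t)) a b); auto.
  intros t Ht; eapply Rle_trans; [apply re_le_Cmod|auto]. }
assert (B2 : Rabs (Im I) <= (b - a) * M).
{ apply (norm_RInt_le_const (V := R_NormedModule) (fun t => Im (f t)) a b); auto.
  intros t Ht; eapply Rle_trans; [apply im_le_Cmod|auto]. }
eapply Rle_trans; [apply Cmod_le_sum|]; lra.
Qed.

(** By [cderiv_curve] the integrand is the derivative of [F] along the curve, so the fundamental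
    theorem applies to each component. *)
Lemma is_CInt_derive (F g : C -> C) (x y dx dy : R -> R) (a b : R) :
  (forall t, is_derive x t (dx t)) -> (forall t, is_derive y t (dy t)) ->
  (forall t, continuous dx t) -> (forall t, continuous dy t) ->
  (forall t, Rmin a b <= t <= Rmax a b -> cderiv F (x t, y t) (g (x t, y t))) ->
  (forall t, Rmin a b <= t <= Rmax a b -> ccont g (x t, y t)) ->
  is_CInt (fun t => g (x t, y t) * (dx t, dy t))%C a b (F (x b, y b) - F (x a, y a))%C.
Proof.
intros Hx Hy Cx Cy HF Hg.
assert (Cg : forall t, Rmin a b <= t <= Rmax a b ->
  ccont (fun t => g (x t, y t) * (dx t, dy t))%C t).
{ intros t Ht; apply continuous_Cmult.
  - apply (continuous_comp (V := C_UniformSpace) (W := C_UniformSpace)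
      (fun t => (x t, y t)) g); auto.
    apply continuous_pair; simpl; apply (ex_derive_continuous (V := R_NormedModule));
    eexists; eauto.
  - apply continuous_pair; simpl; auto. }
split.
- change (Re (F (x b, y b) - F (x a, y a))%C)
    with (minus (Re (F (x b, y b))) (Re (F (x a, y a)))).
  apply (is_RInt_derive (V := R_CompleteNormedModule) (fun t => Re (F (x t, y t)))).
  + intros t Ht; apply (cderiv_curve F x y t (dx t) (dy t)); auto.
  + intros t Ht; now apply continuous_Re, Cg.
- change (Im (F (x b, y b) - F (x a, y a))%C)
    with (minus (Im (F (x b, y b))) (Im (F (x a, y a)))).
  apply (is_RInt_derive (V := R_CompleteNormedModule) (fun t => Im (F (x t, y t)))).
  + intros t Ht; apply (cderiv_curve F x y t (dx t) (dy t)); auto.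
  + intros t Ht; now apply continuous_Im, Cg.
Qed.

(** * Integrals along segments *)

(** The line integral of [f] over the straight segment from [p] to [q]. *)
Definition seg (f : C -> C) (p q : C) : C :=
  CInt (fun t => f (p + RtoC t * (q - p)) * (q - p))%C 0 1.

Lemma continuous_segment (f : C -> C) (p v : C) (t : R) :
  ccont f (p + RtoC t * v)%C -> ccont (fun s => f (p + RtoC s * v)%C) t.
Proof.
intros Hf.
apply (continuous_comp (V := C_UniformSpace) (W := C_UniformSpace)
  (fun s => p + RtoC s * v)%C f); auto.
apply continuous_Cplus; [apply continuous_const|].
apply continuous_Cmult; [|apply continuous_const].
apply continuous_pair; [apply continuous_id|apply continuous_const].
Qed.

Lemma seg_correct f p q : (forall z, ccont f z) ->
  is_CInt (fun t => f (p + RtoC t * (q - p)) * (q - p))%C 0 1 (seg f p q).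
Proof.
intros Hf; apply CInt_correct; intros t _.
apply continuous_Cmult; [now apply continuous_segment|apply continuous_const].
Qed.

(** The hypotheses are restricted to the segment because [cauchy_int_one] applies this to a function
    differentiated only inside a disc. *)
Lemma seg_FTC (F g : C -> C) (p q : C) :
  (forall t, 0 <= t <= 1 -> cderiv F (p + RtoC t * (q - p))%C (g (p + RtoC t * (q - p))%C)) ->
  (forall t, 0 <= t <= 1 -> ccont g (p + RtoC t * (q - p))%C) ->
  seg g p q = (F q - F p)%C.
Proof.
intros HF Hg; apply is_CInt_unique.
set (v := (q - p)%C) in *.
assert (E : forall t, (p + RtoC t * v)%C = ((Re p + t * Re v)%R, (Im p + t * Im v)%R)).
{ intros t; destruct p, v; unfold RtoC, Cplus, Cmult, Re, Im; simpl; f_equal; ring. }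
replace (F q - F p)%C with
  (F ((Re p + 1 * Re v)%R, (Im p + 1 * Im v)%R) - F ((Re p + 0 * Re v)%R, (Im p + 0 * Im v)%R))%C.
2: { rewrite <- !E; unfold v; f_equal; apply (f_equal F); ring. }
apply is_CInt_ext with
  (fun t => g ((Re p + t * Re v)%R, (Im p + t * Im v)%R) * (Re v, Im v))%C.
{ intros t _; rewrite E; f_equal; now destruct v. }
apply (is_CInt_derive F g (fun t => Re p + t * Re v) (fun t => Im p + t * Im v)
        (fun _ => Re v) (fun _ => Im v)); rewrite ?Rmin_left, ?Rmax_right by lra.
- intros t; auto_derive; [easy|]; apply Rmult_1_l.
- intros t; auto_derive; [easy|]; apply Rmult_1_l.
- intros t; apply continuous_const.
- intros t; apply continuous_const.
- intros t Ht; rewrite <- E; auto.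
- intros t Ht; rewrite <- E; auto.
Qed.

Lemma seg_minus f g p q : (forall z, ccont f z) -> (forall z, ccont g z) ->
  seg (fun z => f z - g z)%C p q = (seg f p q - seg g p q)%C.
Proof.
intros Hf Hg; apply is_CInt_unique.
apply (is_CInt_ext (fun t => f (p + RtoC t * (q - p)) * (q - p)
                             - g (p + RtoC t * (q - p)) * (q - p))%C).
{ intros t _; ring. }
apply is_CInt_minus; now apply seg_correct.
Qed.

Lemma seg_bound f p q M : (forall z, ccont f z) ->
  (forall t, 0 <= t <= 1 -> Cmod (f (p + RtoC t * (q - p))%C) <= M) ->
  Cmod (seg f p q) <= 2 * M * Cmod (q - p).
Proof.
intros Hf HM.
replace (2 * M * Cmod (q - p)) with (2 * (M * Cmod (q - p)) * (1 - 0)) by ring.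
eapply is_CInt_bound; [lra| |now apply seg_correct].
intros t Ht; simpl; rewrite Cmod_mult.
apply Rmult_le_compat_r; [apply Cmod_ge_0|auto].
Qed.

Lemma seg_rev f p q : (forall z, ccont f z) -> seg f q p = (- seg f p q)%C.
Proof.
intros Hf; apply is_CInt_unique.
apply is_CInt_ext with (fun t => RtoC (-1) *
   (f (p + RtoC (-1 * t + 1)%R * (q - p)) * (q - p)))%C.
{ intros t _.
  replace (p + RtoC (-1 * t + 1)%R * (q - p))%C with (q + RtoC t * (p - q))%C;
  rewrite ?RtoC_plus, ?RtoC_mult, ?RtoC_opp; ring. }
apply (is_CInt_comp_lin (fun t => f (p + RtoC t * (q - p)) * (q - p))%C).
replace (-1 * 0 + 1)%R with 1 by ring. replace (-1 * 1 + 1)%R with 0 by ring.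
destruct (seg_correct f p q Hf) as [H1 H2].
split; simpl; now apply (is_RInt_swap (V := R_NormedModule)).
Qed.

(** Here [v] is half the displacement, so halving becomes addition; the two halves are
    reparametrized by [2 * t] and [2 * t - 1]. *)
Lemma seg_split f p v : (forall z, ccont f z) ->
  seg f p (p + v + v)%C = (seg f p (p + v)%C + seg f (p + v)%C (p + v + v)%C)%C.
Proof.
intros Hf; apply is_CInt_unique.
apply is_CInt_Chasles with (1 / 2).
- apply is_CInt_ext with (fun t => RtoC 2 * (f (p + RtoC (2 * t + 0)%R * (p + v - p)) * (p + v - p)))%C.
  { intros t _.
    replace (p + RtoC t * (p + v + v - p))%C with (p + RtoC (2 * t + 0)%R * (p + v - p))%C;
    rewrite ?RtoC_plus, ?RtoC_mult; ring. }
  apply (is_CInt_comp_lin (fun t => f (p + RtoC t * (p + v - p)) * (p + v - p))%C).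
  replace (2 * 0 + 0)%R with 0 by ring. replace (2 * (1 / 2) + 0)%R with 1 by field.
  now apply seg_correct.
- apply is_CInt_ext with (fun t => RtoC 2 * (f (p + v + RtoC (2 * t + -1)%R * (p + v + v - (p + v))) * (p + v + v - (p + v))))%C.
  { intros t _.
    replace (p + RtoC t * (p + v + v - p))%C with (p + v + RtoC (2 * t + -1)%R * (p + v + v - (p + v)))%C;
    rewrite ?RtoC_plus, ?RtoC_mult, ?RtoC_opp; ring. }
  apply (is_CInt_comp_lin (fun t => f (p + v + RtoC t * (p + v + v - (p + v))) * (p + v + v - (p + v)))%C).
  replace (2 * (1/2) + -1)%R with 0 by field. replace (2 * 1 + -1)%R with 1 by ring.
  now apply seg_correct.
Qed.

(** * Rules of complex differentiation *)

(** Makes the general rules for sums, products and compositions over an absolute-value ring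
    available for [cderiv]. *)
Lemma cderiv_iff (f : C -> C) (z l : C) :
  cderiv f z l <->
  is_derive (K := C_AbsRing) (V := AbsRing_NormedModule C_AbsRing) f z l.
Proof.
split.
- intros H; split; [apply is_linear_scal_l|].
  intros x Hx.
  apply (is_filter_lim_locally_unique (V := AbsRing_NormedModule C_AbsRing) z x) in Hx.
  subst x; intros eps; destruct (H eps (cond_pos eps)) as [d [Hd K]].
  exists (mkposreal d Hd); intros w Hw.
  change (Cmod ((f w - f z) - (w - z) * l)%C <= eps * Cmod (w - z)%C).
  change (Cmod (w - z)%C < d) in Hw.
  assert (E : forall u v : C, (u + (v - u))%C = v) by (intros; ring).
  specialize (K _ Hw); rewrite E in K.
  now rewrite (Cmult_comm (w - z) l).
- intros [_ H] eps Heps.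
  destruct (H z (fun P HP => HP) (mkposreal eps Heps)) as [d Hd].
  exists d; split; [apply cond_pos|]; intros h Hh.
  assert (E : (z + h - z = h)%C) by ring.
  assert (B : Cmod (z + h - z)%C < d) by now rewrite E.
  specialize (Hd (z + h)%C B).
  change (Cmod ((f (z + h) - f z) - (z + h - z) * l)%C <= eps * Cmod (z + h - z)%C) in Hd.
  rewrite E in Hd; now rewrite (Cmult_comm l h).
Qed.

(** Along the horizontal line through [z], with velocity 1, both numbers are the same pair of real
    derivatives. *)
Lemma cderiv_unique f z l m : cderiv f z l -> cderiv f z m -> l = m.
Proof.
destruct z as [x y]; intros Hl Hm.
assert (Hx : is_derive (fun t : R => t) x 1) by apply (is_derive_id (K := R_AbsRing)).
assert (Hy : is_derive (fun _ : R => y) x 0) by apply (is_derive_const (K := R_AbsRing) (V := R_NormedModule)).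
destruct (cderiv_curve f (fun t => t) (fun _ => y) x 1 0 l Hl Hx Hy) as [L1 L2].
destruct (cderiv_curve f (fun t => t) (fun _ => y) x 1 0 m Hm Hx Hy) as [M1 M2].
apply is_derive_unique in L1; apply is_derive_unique in L2.
apply is_derive_unique in M1; apply is_derive_unique in M2.
rewrite <- (Cmult_1_r l), <- (Cmult_1_r m).
apply injective_projections; [transitivity (Re (l * 1)%C)|transitivity (Im (l * 1)%C)];
  try reflexivity.
- exact (eq_trans (eq_sym L1) M1).
- exact (eq_trans (eq_sym L2) M2).
Qed.

Lemma cderiv_ext (f g : C -> C) z l :
  (forall w, f w = g w) -> cderiv f z l -> cderiv g z l.
Proof.
intros E H eps He; destruct (H eps He) as [d [Hd K]]; exists d; split; auto.
intros h Hh; rewrite <- !E; auto.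
Qed.

Lemma cderiv_ext_loc (f g : C -> C) z l r : 0 < r ->
  (forall w, Cmod (w - z) < r -> f w = g w) -> cderiv f z l -> cderiv g z l.
Proof.
intros Hr E H eps He; destruct (H eps He) as [d [Hd K]].
exists (Rmin d r); split; [now apply Rmin_pos|].
intros h Hh; rewrite <- !E.
- apply K; eapply Rlt_le_trans; [exact Hh|apply Rmin_l].
- replace (z - z)%C with (RtoC 0) by ring; now rewrite Cmod_0.
- replace (z + h - z)%C with h by ring; eapply Rlt_le_trans; [exact Hh|apply Rmin_r].
Qed.

Lemma cderiv_const (c z : C) : cderiv (fun _ => c) z 0.
Proof. apply cderiv_iff, (is_derive_const (K := C_AbsRing) (V := AbsRing_NormedModule C_AbsRing)). Qed.

Lemma cderiv_id (z : C) : cderiv (fun w => w) z 1.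
Proof. apply cderiv_iff, (is_derive_id (K := C_AbsRing)). Qed.

Lemma cderiv_plus f g z l m :
  cderiv f z l -> cderiv g z m -> cderiv (fun w => f w + g w)%C z (l + m)%C.
Proof.
rewrite !cderiv_iff.
apply (is_derive_plus (K := C_AbsRing) (V := AbsRing_NormedModule C_AbsRing)).
Qed.

Lemma cderiv_minus f g z l m :
  cderiv f z l -> cderiv g z m -> cderiv (fun w => f w - g w)%C z (l - m)%C.
Proof.
rewrite !cderiv_iff.
apply (is_derive_minus (K := C_AbsRing) (V := AbsRing_NormedModule C_AbsRing)).
Qed.

Lemma cderiv_mult f g z l m :
  cderiv f z l -> cderiv g z m -> cderiv (fun w => f w * g w)%C z (l * g z + f z * m)%C.
Proof.
rewrite !cderiv_iff; intros H1 H2.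
apply (is_derive_mult (K := C_AbsRing)); auto; exact Cmult_comm.
Qed.

Lemma cderiv_scal (c : C) f z l :
  cderiv f z l -> cderiv (fun w => c * f w)%C z (c * l)%C.
Proof.
intros H; replace (c * l)%C with (0 * f z + c * l)%C by ring.
apply cderiv_mult; auto; apply cderiv_const.
Qed.

Lemma cderiv_linear (c z : C) : cderiv (fun w => c * w)%C z c.
Proof.
assert (H := cderiv_scal c _ z _ (cderiv_id z)); now rewrite Cmult_1_r in H.
Qed.

(** The remainder is exactly [h * h / ((z + h) * z * z)], and [Cmod (z + h) >= Cmod z / 2] bounds it
    by [2 * Cmod h ^ 2 / Cmod z ^ 3]; the two radii in the minimum serve these two facts. *)
Lemma cderiv_Cinv (z : C) : z <> RtoC 0 -> cderiv Cinv z (- (/ z * / z))%C.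
Proof.
intros Hz; assert (Hm : 0 < Cmod z) by now apply Cmod_gt_0.
intros eps Heps.
assert (Hq : 0 < eps * (Cmod z ^ 3) / 2).
{ generalize (pow_lt _ 3 Hm); intros; nra. }
exists (Rmin (Cmod z / 2) (eps * (Cmod z ^ 3) / 2)); split.
{ apply Rmin_pos; lra. }
intros h Hh.
assert (H1 : Cmod h < Cmod z / 2) by (eapply Rlt_le_trans; [exact Hh|apply Rmin_l]).
assert (H2 : Cmod h < eps * (Cmod z ^ 3) / 2) by (eapply Rlt_le_trans; [exact Hh|apply Rmin_r]).
assert (B : Cmod z / 2 <= Cmod (z + h)).
{ replace z with (z + h + - h)%C in H1 |- * at 1 by ring.
  generalize (Cmod_triangle (z + h) (- h)); rewrite Cmod_opp.
  replace (z + h + - h)%C with z in * by ring; lra. }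
assert (Hzh : (z + h)%C <> RtoC 0) by (apply Cmod_gt_0; lra).
replace (/ (z + h) - / z - - (/ z * / z) * h)%C with (h * h * (/ (z + h) * (/ z * / z)))%C
  by (field; auto).
rewrite !Cmod_mult, !Cmod_inv; auto.
assert (I : / Cmod (z + h) <= / (Cmod z / 2)) by (apply Rinv_le_contravar; lra).
assert (I0 : 0 < / Cmod z) by now apply Rinv_0_lt_compat.
assert (P := Cmod_ge_0 h).
rewrite (Rmult_comm eps), Rmult_assoc; apply Rmult_le_compat_l; auto.
apply Rle_trans with (Cmod h * (/ (Cmod z / 2) * (/ Cmod z * / Cmod z))).
{ apply Rmult_le_compat_l; auto; apply Rmult_le_compat_r; nra. }
replace (Cmod h * (/ (Cmod z / 2) * (/ Cmod z * / Cmod z)))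
  with (Cmod h * (2 / Cmod z ^ 3)) by (field; lra).
apply Rle_trans with (eps * Cmod z ^ 3 / 2 * (2 / Cmod z ^ 3)).
- apply Rmult_le_compat_r; [|lra].
  apply Rlt_le, Rdiv_lt_0_compat; [lra|now apply pow_lt].
- right; field; lra.
Qed.

Lemma cderiv_comp f g z l m :
  cderiv f (g z) l -> cderiv g z m -> cderiv (fun w => f (g w)) z (l * m)%C.
Proof.
rewrite !cderiv_iff, Cmult_comm.
apply (is_derive_comp (K := C_AbsRing) (V := AbsRing_NormedModule C_AbsRing)).
Qed.

(** * Goursat's lemma *)

(** The steps from index [n] on sum to at most the geometric tail [2 * K / 2 ^ n], so the sequence
    is Cauchy and the tail bounds its distance to the limit. *)
Lemma dyadic_limit (x : nat -> R) (K : R) :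
  (forall n, Rabs (x (S n) - x n) <= K / 2 ^ n) ->
  exists l, forall n, Rabs (x n - l) <= 2 * K / 2 ^ n.
Proof.
intros H.
assert (P2 : forall n, 0 < 2 ^ n) by (intros; apply pow_lt; lra).
(* Keeping the subtracted remainder of the geometric series is what lets the induction on [k]
   close. *)
assert (S1 : forall n k, Rabs (x (n + k)%nat - x n) <= 2 * K / 2 ^ n - 2 * K / 2 ^ (n + k)).
{ intros n k; induction k as [|k IH].
  - rewrite Nat.add_0_r, Rminus_diag, Rabs_R0; lra.
  - rewrite Nat.add_succ_r.
    replace (x (S (n + k)) - x n) with ((x (S (n + k)) - x (n + k)%nat) + (x (n + k)%nat - x n)) by ring.
    eapply Rle_trans; [apply Rabs_triang|].
    specialize (H (n + k)%nat).
    replace (2 * K / 2 ^ S (n + k)) with (K / 2 ^ (n + k))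
      by (simpl; field; generalize (P2 (n + k)%nat); lra).
    lra. }
assert (K0 : 0 <= K).
{ generalize (H 0%nat) (Rabs_pos (x 1%nat - x 0%nat)); simpl; lra. }
assert (S2 : forall n k, Rabs (x (n + k)%nat - x n) <= 2 * K / 2 ^ n).
{ intros n k; eapply Rle_trans; [apply S1|].
  assert (0 <= 2 * K / 2 ^ (n + k)).
  { apply Rmult_le_pos; [lra|]. apply Rlt_le, Rinv_0_lt_compat, P2. }
  lra. }
assert (Z : forall e, 0 < e -> exists n, 2 * K / 2 ^ n < e).
{ intros e He.
  destruct (pow_lt_1_zero (/ 2)) with (y := e / (2 * K + 1)) as [n Hn].
  - rewrite Rabs_pos_eq; lra.
  - apply Rdiv_lt_0_compat; lra.
  - exists n; specialize (Hn n (le_n n)).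
    rewrite Rabs_pos_eq in Hn by (apply pow_le; lra).
    rewrite pow_inv in Hn.
    apply Rle_lt_trans with ((2 * K + 1) * / 2 ^ n).
    + unfold Rdiv; apply Rmult_le_compat_r; [|lra].
      apply Rlt_le, Rinv_0_lt_compat, P2.
    + apply Rmult_lt_compat_l with (r := 2 * K + 1) in Hn; [|lra].
      replace ((2 * K + 1) * (e / (2 * K + 1))) with e in Hn by (field; lra). lra. }
destruct (Rcomplete.R_complete x) as [l Hl].
{ intros e He; destruct (Z (e / 2)) as [N HN]; [lra|].
  exists N; intros n m Hn Hm; unfold Rdist.
  assert (A1 := S2 N (n - N)%nat); assert (A2 := S2 N (m - N)%nat).
  replace (N + (n - N))%nat with n in A1 by lia.
  replace (N + (m - N))%nat with m in A2 by lia.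
  replace (x n - x m) with ((x n - x N) - (x m - x N)) by ring.
  eapply Rle_lt_trans; [apply Rabs_triang|]; rewrite Rabs_Ropp; lra. }
exists l; intros n; apply le_epsilon; intros e He.
destruct (Hl e He) as [N HN].
specialize (HN (n + N)%nat); unfold Rdist in HN.
specialize (S2 n N).
replace (x n - l) with ((x (n + N)%nat - l) - (x (n + N)%nat - x n)) by ring.
eapply Rle_trans; [apply Rabs_triang|]; rewrite Rabs_Ropp.
assert (Rabs (x (n + N)%nat - l) < e) by (apply HN; lia). lra.
Qed.

(* [bad p s] is meant for the triangle with corner [p] homothetic to a fixed one with
   signed ratio [s]: the middle triangle of a subdivision has ratio [- s / 2]. *)
Lemma bisection_limit (bad : C -> R -> Prop) (L : R) (p0 : C) :
  (forall p s, bad p s -> exists p' s', Rabs s' = Rabs s / 2 /\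
     Cmod (p' - p) <= L * Rabs s /\ bad p' s') ->
  bad p0 1 ->
  exists z, forall d, 0 < d -> exists p s,
    Rabs s < d /\ Cmod (p - z) <= 4 * L * Rabs s /\ bad p s.
Proof.
intros step H0.
(* Each bad pair carries its proof of badness, so a choice of successor can be iterated by plain
   recursion. *)
pose (T := {q : C * R | bad (fst q) (snd q)}).
assert (nxt : forall q : T, {q' : T |
   Rabs (snd (proj1_sig q')) = Rabs (snd (proj1_sig q)) / 2 /\
   Cmod (fst (proj1_sig q') - fst (proj1_sig q)) <= L * Rabs (snd (proj1_sig q))}).
{ intros [[p s] Hb]; apply constructive_indefinite_description.
  destruct (step p s Hb) as (p' & s' & A1 & A2 & A3).
  now exists (exist (fun q : C * R => bad (fst q) (snd q)) (p', s') A3). }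
pose (u := fix u n : T := match n with
  | O => exist (fun q : C * R => bad (fst q) (snd q)) (p0, 1) H0
  | S m => proj1_sig (nxt (u m)) end).
pose (p n := fst (proj1_sig (u n))); pose (s n := snd (proj1_sig (u n))).
assert (Hs : forall n, Rabs (s n) = / 2 ^ n).
{ induction n as [|n IH].
  - unfold s; simpl; rewrite Rabs_R1; field.
  - unfold s; simpl; destruct (nxt (u n)) as [q' [A1 A2]]; simpl.
    rewrite A1. fold (s n); rewrite IH; field; apply pow_nonzero; lra. }
assert (Hp : forall n, Cmod (p (S n) - p n) <= L / 2 ^ n).
{ intros n; unfold Rdiv; rewrite <- Hs; unfold p, s; simpl.
  destruct (nxt (u n)) as [q' [A1 A2]]; exact A2. }
destruct (dyadic_limit (fun n => Re (p n)) L) as [x Hx].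
{ intros n; eapply Rle_trans; [|apply Hp]; apply (re_le_Cmod (p (S n) - p n)). }
destruct (dyadic_limit (fun n => Im (p n)) L) as [y Hy].
{ intros n; eapply Rle_trans; [|apply Hp]; apply (im_le_Cmod (p (S n) - p n)). }
exists (x, y); intros d Hd.
destruct (pow_lt_1_zero (/ 2)) with (y := d) as [n Hn]; auto.
{ rewrite Rabs_pos_eq; lra. }
exists (p n), (s n); split; [|split].
- specialize (Hn n (le_n n)). rewrite Rabs_pos_eq in Hn by (apply pow_le; lra).
  now rewrite Hs, <- pow_inv.
(* Real and imaginary parts are each within [2 * L / 2 ^ n] of their limits, whence the factor 4. *)
- eapply Rle_trans; [apply Cmod_le_sum|]. rewrite Hs.
  specialize (Hx n); specialize (Hy n).
  change (Rabs (Re (p n) - x) + Rabs (Im (p n) - y) <= 4 * L * / 2 ^ n).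
  unfold Rdiv in *; lra.
- unfold p, s; destruct (u n) as [q Hq]; exact Hq.
Qed.

Definition tri (f : C -> C) (p q r : C) : C := (seg f p q + seg f q r + seg f r p)%C.

Lemma seg_mid (f : C -> C) p m q : (forall z, ccont f z) -> (p + q = m + m)%C ->
  seg f p q = (seg f p m + seg f m q)%C.
Proof.
intros Hf E.
generalize (seg_split f p (m - p)%C Hf).
replace (p + (m - p) + (m - p))%C with q
  by (transitivity (p + q - p)%C; [ring|rewrite E; ring]).
now replace (p + (m - p))%C with m by ring.
Qed.

(** Subdivision at the midpoints of the sides: the sides of the middle triangle are run through once
    in each direction and cancel. *)
Lemma tri_quad (f : C -> C) p q r m1 m2 m3 : (forall z, ccont f z) ->
  (p + q = m1 + m1)%C -> (q + r = m2 + m2)%C -> (r + p = m3 + m3)%C ->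
  tri f p q r = (tri f p m1 m3 + tri f m1 q m2 + tri f m3 m2 r + tri f m2 m3 m1)%C.
Proof.
intros Hf E1 E2 E3; unfold tri.
rewrite (seg_mid f p m1 q), (seg_mid f q m2 r), (seg_mid f r m3 p); auto.
rewrite (seg_rev f m1 m3), (seg_rev f m2 m1), (seg_rev f m3 m2); auto; ring.
Qed.

Lemma tri_exact (F g : C -> C) p q r :
  (forall z, cderiv F z (g z)) -> (forall z, ccont g z) -> tri g p q r = RtoC 0.
Proof.
intros HF Hg; unfold tri.
rewrite !(seg_FTC F g) by auto; ring.
Qed.

Lemma seg_dist (p u v : C) (t K : R) : 0 <= t <= 1 ->
  Cmod (u - p) <= K -> Cmod (v - p) <= K -> Cmod (u + RtoC t * (v - u) - p) <= K.
Proof.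
intros Ht Hu Hv.
replace (u + RtoC t * (v - u) - p)%C with (RtoC (1 - t) * (u - p) + RtoC t * (v - p))%C
  by (rewrite RtoC_minus; ring).
eapply Rle_trans; [apply Cmod_triangle|].
rewrite !Cmod_mult, !Cmod_R, !Rabs_pos_eq by lra; nra.
Qed.

(** On the segment [f] is at most [e * K], the length is at most [2 * K], and [seg_bound]
    contributes another factor 2. *)
Lemma seg_small (f : C -> C) (z u v : C) (d e K : R) : (forall z, ccont f z) ->
  0 <= e -> (forall w, Cmod (w - z) < d -> Cmod (f w) <= e * Cmod (w - z)) ->
  K < d -> Cmod (u - z) <= K -> Cmod (v - z) <= K ->
  Cmod (seg f u v) <= 4 * e * K * K.
Proof.
intros Hf He H HK Hu Hv.
assert (K0 := Rle_trans _ _ _ (Cmod_ge_0 _) Hu).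
eapply Rle_trans; [apply (seg_bound f u v (e * K) Hf)|].
- intros t Ht.
  assert (B := seg_dist z u v t K Ht Hu Hv).
  eapply Rle_trans; [apply H; lra|]. now apply Rmult_le_compat_l.
- replace (v - u)%C with ((v - z) + - (u - z))%C by ring.
  assert (B := Cmod_triangle (v - z) (- (u - z))); rewrite Cmod_opp in B.
  replace (4 * e * K * K) with (2 * (e * K) * (K + K)) by ring.
  apply Rmult_le_compat_l; [nra|lra].
Qed.

Lemma cderiv_affine (b l z w : C) : cderiv (fun w => b + l * (w - z))%C w l.
Proof.
apply (cderiv_ext (fun w => (b - l * z) + l * w)%C); [intros; ring|].
assert (P := cderiv_plus _ _ w _ _ (cderiv_const (b - l * z)%C w) (cderiv_linear l w)).
now rewrite Cplus_0_l in P.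
Qed.

(** An explicit primitive of the first-order Taylor polynomial at [z]: its triangle integrals vanish
    and its segment integrals can be computed. *)
Lemma cderiv_quadratic (b l z w : C) :
  cderiv (fun w => b * w + l * ((w - z) * (w - z) * RtoC (/ 2)))%C w (b + l * (w - z))%C.
Proof.
replace (b + l * (w - z))%C with (b * 1 + l *
   (((1 - 0) * (w - z) + (w - z) * (1 - 0)) * RtoC (/ 2) + (w - z) * (w - z) * 0))%C.
- apply cderiv_plus; apply cderiv_scal; [apply cderiv_id|].
  apply (cderiv_mult (fun w => (w - z) * (w - z))%C (fun _ => RtoC (/ 2)));
    [|apply cderiv_const].
  apply (cderiv_mult (fun w => w - z)%C (fun w => w - z)%C);
  apply cderiv_minus; (apply cderiv_id || apply cderiv_const).
- rewrite RtoC_inv by lra; field.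
Qed.

Lemma Goursat (f : C -> C) (p e1 e2 : C) :
  (forall z, exists l, cderiv f z l) -> tri f p (p + e1)%C (p + e2)%C = RtoC 0.
Proof.
intros Hf.
assert (Cf : forall z, ccont f z).
{ intros z; destruct (Hf z) as [l Hl]; now apply cderiv_continuous with l. }
apply NNPP; intros Hne; apply Cmod_gt_0 in Hne.
(* Half of the supposed nonzero value, so that the initial triangle, of ratio 1, is strictly bad. *)
pose (eta := Cmod (tri f p (p + e1)%C (p + e2)%C) / 2).
pose (L := Cmod e1 + Cmod e2).
assert (HL1 := Cmod_ge_0 e1). assert (HL2 := Cmod_ge_0 e2).
(* The threshold scales like the area: it is divided by 4 when the ratio is halved. *)
pose (bad p s := eta * s ^ 2 <
  Cmod (tri f p (p + RtoC s * e1)%C (p + RtoC s * e2)%C)).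
destruct (bisection_limit bad L p) as [z Hz].
- intros q s Hb.
  pose (m1 := (q + RtoC (s / 2) * e1)%C). pose (m3 := (q + RtoC (s / 2) * e2)%C).
  pose (m2 := (q + RtoC (s / 2) * e1 + RtoC (s / 2) * e2)%C).
  assert (Es : RtoC s = (RtoC (s / 2) + RtoC (s / 2))%C).
  { rewrite <- RtoC_plus; f_equal; field. }
  assert (Hs2 : Rabs (s / 2) = Rabs s / 2).
  { unfold Rdiv; rewrite Rabs_mult, (Rabs_pos_eq (/ 2)); lra. }
  assert (Hs0 := Rabs_pos s).
  unfold bad in Hb.
  rewrite (tri_quad f q _ _ m1 m2 m3 Cf) in Hb;
    [|unfold m1, m2, m3; rewrite Es; ring ..].
  assert (B := Cmod_triangle (tri f q m1 m3 + tri f m1 (q + RtoC s * e1)%C m2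
     + tri f m3 m2 (q + RtoC s * e2)%C)%C (tri f m2 m3 m1)).
  assert (B1 := Cmod_triangle (tri f q m1 m3 + tri f m1 (q + RtoC s * e1)%C m2)%C
     (tri f m3 m2 (q + RtoC s * e2)%C)).
  assert (B2 := Cmod_triangle (tri f q m1 m3) (tri f m1 (q + RtoC s * e1)%C m2)).
  assert (D1 : Cmod (RtoC (s / 2) * e1) <= L * Rabs s).
  { rewrite Cmod_mult, Cmod_R, Hs2; unfold L; nra. }
  assert (D2 : Cmod (RtoC (s / 2) * e2) <= L * Rabs s).
  { rewrite Cmod_mult, Cmod_R, Hs2; unfold L; nra. }
  assert (D3 : Cmod (RtoC (s / 2) * e1 + RtoC (s / 2) * e2) <= L * Rabs s).
  { eapply Rle_trans; [apply Cmod_triangle|].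
    rewrite !Cmod_mult, Cmod_R, Hs2; unfold L; nra. }
  (* If all four parts were at most [eta * (s / 2) ^ 2], the whole would be at most [eta * s ^ 2],
     against [Hb]. *)
  destruct (Rlt_le_dec (eta * (s / 2) ^ 2) (Cmod (tri f q m1 m3))) as [c1|c1].
  { exists q, (s / 2); repeat split; auto.
    replace (q - q)%C with (RtoC 0) by ring; rewrite Cmod_0; unfold L; nra. }
  destruct (Rlt_le_dec (eta * (s / 2) ^ 2) (Cmod (tri f m1 (q + RtoC s * e1)%C m2))) as [c2|c2].
  { exists m1, (s / 2); repeat split; auto.
    - unfold m1; now replace (q + RtoC (s / 2) * e1 - q)%C with (RtoC (s / 2) * e1)%C by ring.
    - unfold bad; replace (m1 + RtoC (s / 2) * e1)%C with (q + RtoC s * e1)%C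
        by (unfold m1; rewrite Es; ring). exact c2. }
  destruct (Rlt_le_dec (eta * (s / 2) ^ 2) (Cmod (tri f m3 m2 (q + RtoC s * e2)%C))) as [c3|c3].
  { exists m3, (s / 2); repeat split; auto.
    - unfold m3; now replace (q + RtoC (s / 2) * e2 - q)%C with (RtoC (s / 2) * e2)%C by ring.
    - unfold bad; replace (m3 + RtoC (s / 2) * e2)%C with (q + RtoC s * e2)%C
        by (unfold m3; rewrite Es; ring).
      replace (m3 + RtoC (s / 2) * e1)%C with m2 by (unfold m2, m3; ring). exact c3. }
  destruct (Rlt_le_dec (eta * (s / 2) ^ 2) (Cmod (tri f m2 m3 m1))) as [c4|c4].
  (* The middle triangle is the reversed one: seen from [m2], its edges are [- s / 2] times [e1] and
     [e2]. *)
  { exists m2, (- (s / 2)); repeat split; auto.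
    - now rewrite Rabs_Ropp.
    - unfold m2; now replace (q + RtoC (s / 2) * e1 + RtoC (s / 2) * e2 - q)%C
        with (RtoC (s / 2) * e1 + RtoC (s / 2) * e2)%C by ring.
    - unfold bad; rewrite RtoC_opp.
      replace (m2 + - RtoC (s / 2) * e1)%C with m3 by (unfold m2, m3; ring).
      replace (m2 + - RtoC (s / 2) * e2)%C with m1 by (unfold m2, m1; ring).
      now replace ((- (s / 2)) ^ 2) with ((s / 2) ^ 2) by ring. }
  exfalso; lra.
- unfold bad; rewrite !Cmult_1_l; unfold eta; simpl; lra.
- destruct (Hf z) as [l Hl].
  (* The constant is [3 * 4 * 5 ^ 2]: three sides, the 4 of [seg_small], and vertices within
     [5 * L * Rabs s] of [z]. Adding 1 keeps the denominator positive when [L] is 0. *)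
  pose (e := eta / (300 * L * L + 1)).
  assert (HLL : 0 <= L * L) by nra.
  assert (He : 0 < e) by (apply Rdiv_lt_0_compat; unfold eta; lra).
  destruct (Hl e He) as [d [Hd K]].
  pose (A w := (f z + l * (w - z))%C).
  pose (r w := (f w - A w)%C).
  assert (HA : forall w, cderiv A w l).
  { intros w; apply cderiv_affine. }
  assert (CA : forall w, ccont A w) by (intros w; now apply cderiv_continuous with l).
  assert (Cr : forall w, ccont r w).
  { intros w; destruct (Hf w) as [lw Hw]; apply cderiv_continuous with (lw - l)%C.
    now apply cderiv_minus. }
  assert (Hr : forall w, Cmod (w - z) < d -> Cmod (r w) <= e * Cmod (w - z)).
  { intros w Hw; specialize (K _ Hw); replace (z + (w - z))%C with w in K by ring.
    replace (r w) with (f w - f z - l * (w - z))%C by (unfold r, A; ring). exact K. }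
  destruct (Hz (d / (5 * L + 1))) as (q & s & Hs & Hq & Hb).
  { apply Rdiv_lt_0_compat; unfold L; lra. }
  assert (Hs0 := Rabs_pos s).
  (* The corner [q] is within [4 * L * Rabs s] of [z], and an edge adds at most [L * Rabs s]. *)
  set (K5 := 5 * L * Rabs s).
  assert (HK5 : K5 < d).
  { apply Rmult_lt_compat_l with (r := 5 * L + 1) in Hs; [|unfold L; lra].
    replace ((5 * L + 1) * (d / (5 * L + 1))) with d in Hs by (field; unfold L; lra).
    unfold K5; lra. }
  assert (Q0 : Cmod (q - z) <= K5) by (unfold K5, L in *; nra).
  assert (Q1 : Cmod (q + RtoC s * e1 - z) <= K5).
  { replace (q + RtoC s * e1 - z)%C with ((q - z) + RtoC s * e1)%C by ring.
    eapply Rle_trans; [apply Cmod_triangle|]. rewrite Cmod_mult, Cmod_R.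
    unfold K5, L in *; nra. }
  assert (Q2 : Cmod (q + RtoC s * e2 - z) <= K5).
  { replace (q + RtoC s * e2 - z)%C with ((q - z) + RtoC s * e2)%C by ring.
    eapply Rle_trans; [apply Cmod_triangle|]. rewrite Cmod_mult, Cmod_R.
    unfold K5, L in *; nra. }
  (* The affine part [A] has a quadratic primitive, so only the remainder [r] contributes. *)
  assert (Et : tri f q (q + RtoC s * e1)%C (q + RtoC s * e2)%C =
               tri r q (q + RtoC s * e1)%C (q + RtoC s * e2)%C).
  { assert (T0 := tri_exact (fun w => f z * w + l * ((w - z) * (w - z) * RtoC (/ 2)))%C A
       q (q + RtoC s * e1)%C (q + RtoC s * e2)%C).
    unfold tri in *; unfold r; rewrite !seg_minus by auto.
    match type of T0 with _ -> _ -> ?X = _ =>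
      transitivity (seg f q (q + RtoC s * e1) + seg f (q + RtoC s * e1) (q + RtoC s * e2)
         + seg f (q + RtoC s * e2) q - X)%C; [|ring] end.
    rewrite T0; auto; [ring|].
    intros w; apply cderiv_quadratic. }
  unfold bad in Hb; rewrite Et in Hb; unfold tri in Hb.
  assert (S1 := seg_small r z q (q + RtoC s * e1)%C d e K5 Cr (Rlt_le _ _ He) Hr HK5 Q0 Q1).
  assert (S2 := seg_small r z (q + RtoC s * e1)%C (q + RtoC s * e2)%C d e K5 Cr (Rlt_le _ _ He) Hr HK5 Q1 Q2).
  assert (S3 := seg_small r z (q + RtoC s * e2)%C q d e K5 Cr (Rlt_le _ _ He) Hr HK5 Q2 Q0).
  assert (B := Cmod_triangle (seg r q (q + RtoC s * e1) + seg r (q + RtoC s * e1) (q + RtoC s * e2))%C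
     (seg r (q + RtoC s * e2) q)).
  assert (B1 := Cmod_triangle (seg r q (q + RtoC s * e1)) (seg r (q + RtoC s * e1) (q + RtoC s * e2))).
  assert (T : eta * s ^ 2 < 12 * e * K5 * K5) by lra.
  assert (Ek : 12 * e * K5 * K5 = (e * (300 * L * L)) * s ^ 2).
  { unfold K5; rewrite <- (pow2_abs s); ring. }
  assert (Ee : e * (300 * L * L) <= eta).
  { replace eta with (e * (300 * L * L + 1)) by (unfold e; field; lra).
    apply Rmult_le_compat_l; lra. }
  assert (P := pow2_ge_0 s). rewrite Ek in T.
  apply Rmult_le_compat_r with (r := s ^ 2) in Ee; lra.
Qed.

(** * Primitives and difference quotients *)

(** Goursat's lemma for the triangle [0], [z], [z + h] turns the increment of [seg f 0] into
    [seg f z (z + h)], which continuity compares with [f z * h]. *)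
Lemma primitive_exists (f : C -> C) :
  (forall z, exists l, cderiv f z l) -> forall z, cderiv (seg f 0) z (f z).
Proof.
intros Hf z.
assert (Cf : forall z, ccont f z).
{ intros w; destruct (Hf w) as [l Hl]; now apply cderiv_continuous with l. }
assert (E : forall h, (seg f 0 (z + h) - seg f 0 z)%C = seg f z (z + h)%C).
{ intros h; assert (G := Goursat f 0 z (z + h)%C Hf); unfold tri in G.
  rewrite !Cplus_0_l in G. rewrite (seg_rev f 0 (z + h)%C Cf) in G.
  transitivity (seg f z (z + h) - (seg f 0 z + seg f z (z + h) + - seg f 0 (z + h)))%C;
    [ring|rewrite G; ring]. }
intros eps He.
destruct (proj1 (continuous_C_eps f z) (Cf z) (eps / 2)) as [d [Hd K]]; [lra|].
exists d; split; auto; intros h Hh; rewrite E.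
assert (E2 : seg (fun _ => f z) z (z + h)%C = (f z * h)%C).
{ rewrite (seg_FTC (fun w => f z * w)%C (fun _ => f z)); [ring| |].
  - intros t _; apply cderiv_linear.
  - intros t _; apply continuous_const. }
rewrite <- E2, <- (seg_minus f (fun _ => f z)); auto; [|intros; apply continuous_const].
replace (eps * Cmod h) with (2 * (eps / 2) * Cmod (z + h - z))
  by (replace (z + h - z)%C with h by ring; field).
apply seg_bound.
- intros w; destruct (Hf w) as [l Hl]; apply cderiv_continuous with (l - 0)%C.
  apply cderiv_minus; auto; apply cderiv_const.
- intros t Ht; apply Rlt_le, K.
  replace (z + RtoC t * (z + h - z) - z)%C with (RtoC t * h)%C by ring.
  rewrite Cmod_mult, Cmod_R, Rabs_pos_eq by lra.
  generalize (Cmod_ge_0 h); nra.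
Qed.

Definition holomorphic (f : C -> C) : Prop := forall z, exists l, cderiv f z l.

Lemma holomorphic_continuous f : holomorphic f -> forall z, ccont f z.
Proof. intros Hf z; destruct (Hf z) as [l Hl]; now apply cderiv_continuous with l. Qed.

(** The quotient is formed from the primitive because one derivative of [f] at [z] already gives a
    second-order expansion of [seg f 0], which is what differentiability of the quotient at [w = z]
    requires. *)
Lemma quotient_holomorphic (f : C -> C) (z : C) : holomorphic f ->
  exists g, holomorphic g /\
    forall w, w <> z -> g w = ((seg f 0 w - seg f 0 z) * / (w - z))%C.
Proof.
intros Hf.
assert (Cf := holomorphic_continuous f Hf).
set (F := seg f 0).
assert (HF : forall w, cderiv F w (f w)) by now apply primitive_exists.
pose (q w := ((F w - F z) * / (w - z))%C).
exists (fun w => if Ceq_dec w z then f z else q w); split.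
2: { intros w Hw; destruct (Ceq_dec w z); [easy|reflexivity]. }
intros w; destruct (Ceq_dec w z) as [->|Hw].
(* With [l] the derivative of [f] at [z], the increment of [F] is [f z * h + l * h * h / 2] up to a
   small multiple of [h * h]; dividing by [h] leaves the slope [l / 2]. *)
- destruct (Hf z) as [l Hl]; exists (l * RtoC (/ 2))%C.
  intros eps He.
  destruct (Hl (eps / 4)) as [d [Hd K]]; [lra|].
  exists d; split; auto; intros h Hh.
  destruct (Ceq_dec z z) as [_|]; [|easy].
  destruct (Ceq_dec (z + h) z) as [E|E].
  { assert (h0 : h = RtoC 0).
    { transitivity (z + h - z)%C; [ring|rewrite E; ring]. }
    subst h; replace (f z - f z - l * RtoC (/ 2) * 0)%C with (RtoC 0) by ring.
    rewrite Cmod_0; lra. }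
  assert (Hh0 : h <> RtoC 0) by (intros ->; apply E; ring).
  pose (A w := (f z + l * (w - z))%C).
  assert (CA : forall w, ccont A w).
  { intros w; apply cderiv_continuous with l; apply cderiv_affine. }
  assert (Ea : seg A z (z + h)%C = (f z * h + l * (h * h * RtoC (/ 2)))%C).
  { rewrite (seg_FTC _ A z (z + h)%C (fun t _ => cderiv_quadratic (f z) l z _)) by auto.
    ring. }
  assert (Ef : seg f z (z + h)%C = (F (z + h) - F z)%C) by now apply seg_FTC.
  assert (S1 : Cmod (seg (fun w => f w - A w)%C z (z + h)%C) <= 4 * (eps / 4) * Cmod h * Cmod h).
  { apply (seg_small _ z z (z + h)%C d); auto; try lra.
    - intros w; destruct (Hf w) as [m Hm]; apply cderiv_continuous with (m - l)%C.
      apply cderiv_minus; auto; apply cderiv_affine.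
    - intros w Hw; specialize (K _ Hw); replace (z + (w - z))%C with w in K by ring.
      now replace (f w - A w)%C with (f w - f z - l * (w - z))%C by (unfold A; ring).
    - replace (z - z)%C with (RtoC 0) by ring; rewrite Cmod_0; apply Cmod_ge_0.
    - replace (z + h - z)%C with h by ring; lra. }
  rewrite seg_minus, Ea, Ef in S1 by auto.
  assert (Hm : 0 < Cmod h) by now apply Cmod_gt_0.
  apply Rmult_le_reg_r with (Cmod h); auto.
  rewrite <- Cmod_mult; unfold q.
  replace ((((F (z + h) - F z) * / (z + h - z)) - f z - l * RtoC (/ 2) * h) * h)%C
    with (F (z + h) - F z - (f z * h + l * (h * h * RtoC (/ 2))))%C.
  + lra.
  + replace (z + h - z)%C with h by ring; field; auto.
- assert (H0 : (w - z)%C <> RtoC 0).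
  { intros H; apply Hw; transitivity (w - z + z)%C; [ring|rewrite H; ring]. }
  (* The disc of radius [Cmod (w - z)] about [w] avoids [z], so [q] is the extended function
     there. *)
  eexists; apply (cderiv_ext_loc q _ w _ (Cmod (w - z))).
  + now apply Cmod_gt_0.
  + intros v Hv; destruct (Ceq_dec v z) as [->|]; auto.
    rewrite Cmod_minus_sym in Hv; lra.
  + apply cderiv_mult.
    * apply cderiv_minus; [apply HF|apply cderiv_const].
    * apply (cderiv_comp Cinv (fun w => w - z)%C); [now apply cderiv_Cinv|].
      apply cderiv_minus; [apply cderiv_id|apply cderiv_const].
Qed.

(** * Cauchy's formula *)

(** Radius 1 is enough for entire functions and keeps the velocity [dcircle] free of any
    parameter. *)
Definition circle (z0 : C) (t : R) : C := ((Re z0 + cos t)%R, (Im z0 + sin t)%R).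
Definition dcircle (t : R) : C := ((- sin t)%R, cos t).

Lemma circle_dist z0 t : Cmod (circle z0 t - z0) = 1.
Proof.
unfold Cmod, circle; destruct z0 as [x y]; simpl.
replace ((x + cos t + - x) * ((x + cos t + - x) * 1) +
         (y + sin t + - y) * ((y + sin t + - y) * 1)) with 1; [apply sqrt_1|].
generalize (sin2_cos2 t); unfold Rsqr; intros; ring_simplify; lra.
Qed.

Lemma circle_far z0 z t : 1 - Cmod (z - z0) <= Cmod (circle z0 t - z).
Proof.
rewrite <- (circle_dist z0 t).
replace (circle z0 t - z0)%C with ((circle z0 t - z) + (z - z0))%C by ring.
generalize (Cmod_triangle (circle z0 t - z) (z - z0)); lra.
Qed.

Lemma circle_neq z0 z t : Cmod (z - z0) < 1 -> (circle z0 t - z)%C <> RtoC 0.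
Proof. intros H; apply Cmod_gt_0; generalize (circle_far z0 z t); lra. Qed.

Lemma continuous_circle z0 t : ccont (circle z0) t.
Proof.
apply continuous_pair; unfold circle; simpl;
apply (continuous_plus (V := R_NormedModule)); try apply continuous_const;
[apply continuous_cos|apply continuous_sin].
Qed.

Lemma continuous_dcircle t : ccont dcircle t.
Proof.
apply continuous_pair; unfold dcircle; simpl.
- apply (continuous_opp (V := R_NormedModule)), continuous_sin.
- apply continuous_cos.
Qed.

(** The curve is closed, so a primitive has zero increment along it. *)
Lemma circle_exact (F g : C -> C) z0 :
  (forall t, cderiv F (circle z0 t) (g (circle z0 t))) ->
  (forall t, ccont g (circle z0 t)) ->
  is_CInt (fun t => g (circle z0 t) * dcircle t)%C 0 (2 * PI) 0.
Proof.
intros HF Hg.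
assert (E : circle z0 (2 * PI) = circle z0 0).
{ unfold circle; now rewrite cos_2PI, sin_2PI, cos_0, sin_0. }
replace (RtoC 0) with (F (circle z0 (2 * PI)) - F (circle z0 0))%C by (rewrite E; ring).
apply (is_CInt_derive F g (fun t => Re z0 + cos t) (fun t => Im z0 + sin t)
  (fun t => - sin t) cos); auto.
- intros t; auto_derive; auto; ring.
- intros t; auto_derive; auto; ring.
- intros t; apply (continuous_opp (V := R_NormedModule)), continuous_sin.
- intros t; apply continuous_cos.
- intros t _; apply HF.
- intros t _; apply Hg.
Qed.

(** Meant for [x = / (p - (z + h))] and [y = / (p - z)], which satisfy [x - y = h * x * y]. This
    expands the power of the Cauchy kernel to first order in [h], uniformly as long as both inverses
    are bounded by [B]. *)
Lemma inverse_power_expansion (B : R) (n : nat) : 0 <= B -> exists K, 0 <= K /\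
  forall x y h : C, Cmod x <= B -> Cmod y <= B -> (x - y = h * x * y)%C ->
  Cmod (x ^ n - y ^ n - RtoC (INR n) * h * y ^ (S n))%C <= K * (Cmod h * Cmod h).
Proof.
intros HB; induction n as [|n [K [HK IH]]].
- exists 0; split; [lra|]; intros x y h _ _ _; simpl.
  replace (1 - 1 - 0 * h * (y * 1))%C with (RtoC 0) by ring. rewrite Cmod_0; lra.
- exists (B * K + INR (S n) * (B * B ^ (S (S n)))).
  assert (N := pos_INR (S n)).
  assert (PB : 0 <= B * B ^ (S (S n))) by (apply Rmult_le_pos; [lra|now apply pow_le]).
  split; [apply Rplus_le_le_0_compat; now apply Rmult_le_pos|].
  intros x y h Hx Hy E; specialize (IH x y h Hx Hy E).
  (* The new remainder is [x] times the old one plus a term in [h * h]; the difference of the two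
     sides is a multiple of [x - y - h * x * y]. *)
  replace (x ^ S n - y ^ S n - RtoC (INR (S n)) * h * y ^ S (S n))%C
    with (x * (x ^ n - y ^ n - RtoC (INR n) * h * y ^ S n) +
          RtoC (INR (S n)) * (h * h) * (x * y ^ (S (S n))))%C.
  2: { rewrite S_INR, RtoC_plus; simpl.
       assert (E0 : (x - y - h * x * y = 0)%C) by (rewrite E; ring).
       set (N' := RtoC (INR n)); set (Y := (y ^ n)%C); set (X := (x ^ n)%C).
       transitivity (x * (X - Y - N' * h * (y * Y)) + (N' + 1) * (h * h) * (x * (y * (y * Y)))
         + (x - y - h * x * y) * (Y + (N' + 1) * h * y * Y))%C; [rewrite E0|]; ring. }
  eapply Rle_trans; [apply Cmod_triangle|].
  rewrite !Cmod_mult, Cmod_pow, Cmod_R, Rabs_pos_eq by apply pos_INR.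
  assert (Hh := Cmod_ge_0 h). assert (Hx0 := Cmod_ge_0 x).
  assert (PY : Cmod y ^ S (S n) <= B ^ S (S n)) by (apply pow_incr; split; [apply Cmod_ge_0|auto]).
  assert (PY0 : 0 <= Cmod y ^ S (S n)) by (apply pow_le, Cmod_ge_0).
  assert (A1 : Cmod x * Cmod (x ^ n - y ^ n - RtoC (INR n) * h * y ^ S n) <= B * (K * (Cmod h * Cmod h))).
  { apply Rmult_le_compat; auto; apply Cmod_ge_0. }
  assert (A2 : Cmod x * Cmod y ^ S (S n) <= B * B ^ S (S n)) by now apply Rmult_le_compat.
  assert (A3 : INR (S n) * (Cmod h * Cmod h) * (Cmod x * Cmod y ^ S (S n)) <=
               INR (S n) * (Cmod h * Cmod h) * (B * B ^ S (S n))).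
  { apply Rmult_le_compat_l; auto. apply Rmult_le_pos; [apply pos_INR|nra]. }
  lra.
Qed.

Lemma continuous_bounded (f : R -> C) (a b : R) : a <= b -> (forall t, ccont f t) ->
  exists M, forall t, a <= t <= b -> Cmod (f t) <= M.
Proof.
intros Hab Hf.
destruct (continuity_ab_maj (fun t => Rabs (Re (f t)) + Rabs (Im (f t))) a b Hab) as [m [Hm _]].
- intros t _; apply continuity_pt_filterlim.
  apply (continuous_plus (V := R_NormedModule) (fun t => Rabs (Re (f t))) (fun t => Rabs (Im (f t)))).
  + apply (continuous_comp (fun t => Re (f t)) Rabs); [now apply continuous_Re|].
    apply continuous_Rabs.
  + apply (continuous_comp (fun t => Im (f t)) Rabs); [now apply continuous_Im|].
    apply continuous_Rabs.
- exists (Rabs (Re (f m)) + Rabs (Im (f m))); intros t Ht.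
  eapply Rle_trans; [apply Cmod_le_sum|now apply Hm].
Qed.

(** The Cauchy-type integral of order [n]; [phi] contains the velocity of the circle, and a general
    [n] lets one differentiation rule serve every order. *)
Definition cauchy_int (phi : R -> C) (z0 : C) (n : nat) (z : C) : C :=
  CInt (fun t => phi t * (/ (circle z0 t - z)) ^ n)%C 0 (2 * PI).

Lemma continuous_cauchy_kernel (phi : R -> C) z0 n z t : ccont phi t ->
  Cmod (z - z0) < 1 -> ccont (fun t => phi t * (/ (circle z0 t - z)) ^ n)%C t.
Proof.
intros Hp Hz; apply continuous_Cmult; auto.
assert (Ci : ccont (fun t => / (circle z0 t - z))%C t).
{ apply continuous_Cinv; [|now apply circle_neq].
  apply continuous_Cplus; [apply continuous_circle|apply continuous_const]. }
induction n as [|n IH]; simpl; [apply continuous_const|now apply continuous_Cmult].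
Qed.

Lemma cauchy_int_correct (phi : R -> C) z0 n z : (forall t, ccont phi t) ->
  Cmod (z - z0) < 1 ->
  is_CInt (fun t => phi t * (/ (circle z0 t - z)) ^ n)%C 0 (2 * PI) (cauchy_int phi z0 n z).
Proof.
intros Hp Hz; apply CInt_correct; intros t _; now apply continuous_cauchy_kernel.
Qed.

(** Differentiation under the integral sign: the kernel expansion is uniform in [t], so the
    integrated remainder is still quadratic in [h]. Only continuity of [phi] enters. *)
Lemma cderiv_cauchy_int (phi : R -> C) z0 n z : (forall t, ccont phi t) ->
  Cmod (z - z0) < 1 ->
  cderiv (cauchy_int phi z0 n) z (RtoC (INR n) * cauchy_int phi z0 (S n) z)%C.
Proof.
intros Hp Hz.
assert (HPI := PI_RGT_0).
destruct (continuous_bounded phi 0 (2 * PI)) as [M HM]; [lra|auto|].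
assert (M0 : 0 <= M).
{ eapply Rle_trans; [apply Cmod_ge_0|apply (HM 0); lra]. }
(* The point [z] is at distance at least [rho] from the circle; for [Cmod h < rho / 2] both inverse
   kernels are bounded by [2 / rho]. *)
pose (rho := 1 - Cmod (z - z0)); assert (Hrho : 0 < rho) by (unfold rho; lra).
assert (HB : 0 < 2 / rho) by (apply Rdiv_lt_0_compat; lra).
destruct (inverse_power_expansion (2 / rho) n (Rlt_le _ _ HB)) as [K [HK HE]].
intros eps He.
pose (Q := 4 * M * K * PI).
assert (HQ : 0 <= Q) by (unfold Q; apply Rmult_le_pos; [apply Rmult_le_pos; lra|lra]).
exists (Rmin (rho / 2) (eps / (Q + 1))); split.
{ apply Rmin_pos; [lra|apply Rdiv_lt_0_compat; lra]. }
intros h Hh.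
assert (h1 : Cmod h < rho / 2) by (eapply Rlt_le_trans; [exact Hh|apply Rmin_l]).
assert (h2 : Cmod h < eps / (Q + 1)) by (eapply Rlt_le_trans; [exact Hh|apply Rmin_r]).
assert (Hzh : Cmod (z + h - z0) < 1 - rho / 2).
{ replace (z + h - z0)%C with ((z - z0) + h)%C by ring.
  eapply Rle_lt_trans; [apply Cmod_triangle|]; unfold rho in *; lra. }
assert (Hzh1 : Cmod (z + h - z0) < 1) by lra.
assert (inv_le : forall w, rho / 2 <= Cmod w -> w <> RtoC 0 -> Cmod (/ w) <= 2 / rho).
{ intros w Hw Hw0; rewrite Cmod_inv by auto.
  replace (2 / rho) with (/ (rho / 2)) by (field; lra). apply Rinv_le_contravar; lra. }
assert (B := is_CInt_minus _ _ _ _ _ _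
  (is_CInt_minus _ _ _ _ _ _ (cauchy_int_correct phi z0 n (z + h)%C Hp Hzh1)
     (cauchy_int_correct phi z0 n z Hp Hz))
  (is_CInt_scal (RtoC (INR n) * h) _ _ _ _ (cauchy_int_correct phi z0 (S n) z Hp Hz))).
apply (is_CInt_bound _ _ _ _ (M * (K * (Cmod h * Cmod h)))) in B; [|lra|].
- replace (cauchy_int phi z0 n (z + h) - cauchy_int phi z0 n z -
    RtoC (INR n) * cauchy_int phi z0 (S n) z * h)%C with
   (cauchy_int phi z0 n (z + h) - cauchy_int phi z0 n z -
    RtoC (INR n) * h * cauchy_int phi z0 (S n) z)%C by ring.
  eapply Rle_trans; [exact B|].
  replace (2 * (M * (K * (Cmod h * Cmod h))) * (2 * PI - 0)) with (Q * Cmod h * Cmod h)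
    by (unfold Q; ring).
  assert (P := Cmod_ge_0 h).
  apply Rmult_le_compat_r; auto.
  apply Rmult_lt_compat_l with (r := Q + 1) in h2; [|lra].
  replace ((Q + 1) * (eps / (Q + 1))) with eps in h2 by (field; lra). lra.
- intros t Ht.
  replace (phi t * (/ (circle z0 t - (z + h))) ^ n - phi t * (/ (circle z0 t - z)) ^ n
     - RtoC (INR n) * h * (phi t * (/ (circle z0 t - z)) ^ S n))%C with
   (phi t * ((/ (circle z0 t - (z + h))) ^ n - (/ (circle z0 t - z)) ^ n
     - RtoC (INR n) * h * (/ (circle z0 t - z)) ^ S n))%C by ring.
  rewrite Cmod_mult; apply Rmult_le_compat; auto; try apply Cmod_ge_0.
  assert (N1 := circle_neq z0 z t Hz). assert (N2 := circle_neq z0 (z + h)%C t Hzh1).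
  apply HE.
  + apply inv_le; auto; generalize (circle_far z0 (z + h)%C t); lra.
  + apply inv_le; auto; generalize (circle_far z0 z t); unfold rho; lra.
  + field; auto.
Qed.

(** The derivative in [z] integrates the inverse square, which has a primitive on the circle, so it
    vanishes. The integral is thus constant on the disc and is evaluated at the centre. *)
Lemma cauchy_int_one z0 z : Cmod (z - z0) < 1 ->
  cauchy_int dcircle z0 1 z = (RtoC (2 * PI) * Ci)%C.
Proof.
intros Hz.
assert (D : forall w, Cmod (w - z0) < 1 -> cderiv (cauchy_int dcircle z0 1) w 0).
{ intros w Hw.
  replace (RtoC 0) with (RtoC (INR 1) * cauchy_int dcircle z0 2 w)%C.
  { apply cderiv_cauchy_int; auto; apply continuous_dcircle. }
  replace (cauchy_int dcircle z0 2 w) with (RtoC 0); [apply Cmult_0_r|].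
  symmetry; apply is_CInt_unique.
  apply (is_CInt_ext (fun t => (/ (circle z0 t - w) * / (circle z0 t - w)) * dcircle t)%C).
  { intros t _; simpl; ring. }
  apply (circle_exact (fun v => RtoC (-1) * / (v - w))%C (fun v => / (v - w) * / (v - w))%C).
  - intros t; assert (N := circle_neq z0 w t Hw).
    replace (/ (circle z0 t - w) * / (circle z0 t - w))%C with
      (RtoC (-1) * (- (/ (circle z0 t - w) * / (circle z0 t - w)) * (1 - 0)))%C by ring.
    apply cderiv_scal, (cderiv_comp Cinv (fun v => v - w)%C); [now apply cderiv_Cinv|].
    apply cderiv_minus; [apply cderiv_id|apply cderiv_const].
  - intros t; assert (N := circle_neq z0 w t Hw).
    apply continuous_Cmult; (apply continuous_Cinv; auto);
    (apply continuous_Cplus; [apply continuous_id|apply continuous_const]). }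
assert (S0 : seg (fun _ => RtoC 0) z0 z = (cauchy_int dcircle z0 1 z - cauchy_int dcircle z0 1 z0)%C).
{ apply seg_FTC.
  - intros t Ht; apply D.
    replace (z0 + RtoC t * (z - z0) - z0)%C with (RtoC t * (z - z0))%C by ring.
    rewrite Cmod_mult, Cmod_R, Rabs_pos_eq by lra.
    generalize (Cmod_ge_0 (z - z0)); nra.
  - intros; apply continuous_const. }
rewrite (seg_FTC (fun _ => RtoC 0)) in S0; [|intros; apply cderiv_const|intros; apply continuous_const].
transitivity (cauchy_int dcircle z0 1 z0).
{ transitivity (cauchy_int dcircle z0 1 z - cauchy_int dcircle z0 1 z0 + cauchy_int dcircle z0 1 z0)%C;
    [ring|rewrite <- S0; ring]. }
apply is_CInt_unique.
apply (is_CInt_ext (fun _ => Ci)).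
(* At the centre the velocity is [Ci] times the radius vector, so the integrand is the constant
   [Ci]. *)
{ intros t _; simpl.
  assert (E : (circle z0 t - z0)%C = (cos t, sin t)).
  { unfold circle; destruct z0 as [x y]; unfold Cminus, Cplus, Copp; simpl; f_equal; ring. }
  assert (N : (circle z0 t - z0)%C <> RtoC 0).
  { apply circle_neq; replace (z0 - z0)%C with (RtoC 0) by ring; rewrite Cmod_0; lra. }
  replace (dcircle t) with (Ci * (circle z0 t - z0))%C.
  - field; auto.
  - rewrite E; unfold dcircle, Ci, Cmult; simpl; f_equal; ring. }
split; simpl.
- replace (2 * PI * 0 - 0 * 1) with (scal (2 * PI - 0) 0) by (unfold scal; simpl; unfold mult; simpl; ring).
  apply (is_RInt_const (V := R_NormedModule)).
- replace (2 * PI * 1 + 0 * 0) with (scal (2 * PI - 0) 1) by (unfold scal; simpl; unfold mult; simpl; ring).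
  apply (is_RInt_const (V := R_NormedModule)).
Qed.

(** On the circle the kernel times [seg f 0] splits into the entire quotient [g], with integral 0,
    and [seg f 0 z] times the bare kernel. *)
Lemma Cauchy_formula (f : C -> C) z0 z : holomorphic f -> Cmod (z - z0) < 1 ->
  cauchy_int (fun t => seg f 0 (circle z0 t) * dcircle t)%C z0 1 z =
  (RtoC (2 * PI) * Ci * seg f 0 z)%C.
Proof.
intros Hf Hz.
destruct (quotient_holomorphic f z Hf) as [g [Hg Eg]].
assert (Z := circle_exact (seg g 0) g z0 (fun t => primitive_exists g Hg _)
               (fun t => holomorphic_continuous g Hg _)).
rewrite <- (cauchy_int_one z0 z Hz), Cmult_comm.
apply is_CInt_unique.
assert (H := is_CInt_plus _ _ _ _ _ _ Z (is_CInt_scal (seg f 0 z) _ _ _ _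
          (cauchy_int_correct dcircle z0 1 z continuous_dcircle Hz))).
rewrite Cplus_0_l in H.
revert H; apply is_CInt_ext; intros t _.
rewrite Eg; [simpl; ring|].
intros E; apply (circle_neq z0 z t Hz); rewrite E; ring.
Qed.

(** Near [z0] the primitive is a Cauchy integral of order 1; differentiating twice shows [f] and
    then its derivative to be Cauchy integrals of orders 2 and 3, and the latter is differentiable
    again. *)
Lemma holomorphic_derivative (f : C -> C) : holomorphic f ->
  exists f', (forall z, cderiv f z (f' z)) /\ holomorphic f'.
Proof.
intros Hf.
pose (D z := proj1_sig (constructive_indefinite_description _ (Hf z))).
assert (HD : forall z, cderiv f z (D z)).
{ intros z; unfold D; now destruct (constructive_indefinite_description _ (Hf z)). }
exists D; split; auto; intros z0.
pose (phi t := (seg f 0 (circle z0 t) * dcircle t)%C).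
assert (Cphi : forall t, ccont phi t).
{ intros t; apply continuous_Cmult; [|apply continuous_dcircle].
  apply (continuous_comp (V := C_UniformSpace) (W := C_UniformSpace)
    (circle z0) (seg f 0)); [apply continuous_circle|].
  apply cderiv_continuous with (f (circle z0 t)); now apply primitive_exists. }
pose (k := (/ (RtoC (2 * PI) * Ci))%C).
assert (Hk : (RtoC (2 * PI) * Ci)%C <> RtoC 0).
{ apply Cmult_neq_0; [|apply Ci_nz].
  intros H; apply RtoC_inj in H; generalize PI_RGT_0; lra. }
assert (open : forall z, Cmod (z - z0) < 1 -> forall w, Cmod (w - z) < 1 - Cmod (z - z0) ->
   Cmod (w - z0) < 1).
{ intros z Hz w Hw; replace (w - z0)%C with ((w - z) + (z - z0))%C by ring.
  eapply Rle_lt_trans; [apply Cmod_triangle|]; lra. }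
assert (E0 : forall z, Cmod (z - z0) < 1 -> (k * cauchy_int phi z0 1 z)%C = seg f 0 z).
{ intros z Hz; unfold phi; rewrite Cauchy_formula by auto; unfold k.
  now rewrite Cmult_assoc, Cinv_l, Cmult_1_l. }
assert (E1 : forall z, Cmod (z - z0) < 1 -> (k * (RtoC (INR 1) * cauchy_int phi z0 2 z))%C = f z).
{ intros z Hz; apply (cderiv_unique (seg f 0) z); [|now apply primitive_exists].
  apply (cderiv_ext_loc (fun w => k * cauchy_int phi z0 1 w)%C _ _ _ (1 - Cmod (z - z0))).
  - lra.
  - intros w Hw; apply E0; now apply open with z.
  - apply cderiv_scal; now apply cderiv_cauchy_int. }
assert (E2 : forall z, Cmod (z - z0) < 1 ->
   (k * (RtoC (INR 1) * (RtoC (INR 2) * cauchy_int phi z0 3 z)))%C = D z).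
{ intros z Hz; apply (cderiv_unique f z); [|apply HD].
  apply (cderiv_ext_loc (fun w => k * (RtoC (INR 1) * cauchy_int phi z0 2 w))%C _ _ _ (1 - Cmod (z - z0))).
  - lra.
  - intros w Hw; apply E1; now apply open with z.
  - apply cderiv_scal, cderiv_scal; now apply cderiv_cauchy_int. }
assert (Z0 : Cmod (z0 - z0) < 1).
{ replace (z0 - z0)%C with (RtoC 0) by ring; rewrite Cmod_0; lra. }
eexists; apply (cderiv_ext_loc _ _ _ _ 1 Rlt_0_1 E2).
apply cderiv_scal, cderiv_scal, cderiv_scal; now apply cderiv_cauchy_int.
Qed.

(** * Real partial derivatives of holomorphic functions *)

Lemma is_derive_line (g : C -> C) (p v d : C) (t : R) :
  cderiv g (p + RtoC t * v)%C d ->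
  is_derive (fun s => Re (g (p + RtoC s * v)%C)) t (Re (d * v)%C) /\
  is_derive (fun s => Im (g (p + RtoC s * v)%C)) t (Im (d * v)%C).
Proof.
intros H.
assert (E : forall s, (p + RtoC s * v)%C = ((Re p + s * Re v)%R, (Im p + s * Im v)%R)).
{ intros s; destruct p, v; unfold RtoC, Cplus, Cmult, Re, Im; simpl; f_equal; ring. }
rewrite E in H.
destruct (cderiv_curve g (fun s => Re p + s * Re v) (fun s => Im p + s * Im v) t (Re v) (Im v) d)
  as [H1 H2]; auto.
{ auto_derive; [easy|apply Rmult_1_l]. }
{ auto_derive; [easy|apply Rmult_1_l]. }
replace (Re v, Im v) with v in H1, H2 by now destruct v.
split; [revert H1|revert H2]; apply is_derive_ext; intros s; now rewrite E.
Qed.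

Lemma is_derive_u (g : C -> C) (u v : R) (d : C) : cderiv g (u, v) d ->
  is_derive (fun s => Re (g (s, v))) u (Re d) /\
  is_derive (fun s => Im (g (s, v))) u (Im d).
Proof.
intros H; destruct (is_derive_line g (0, v) 1 d u) as [H1 H2].
- replace ((0, v) + RtoC u * 1)%C with ((u, v) : C); auto.
  unfold Cplus, Cmult, RtoC; simpl; f_equal; ring.
- rewrite Cmult_1_r in H1, H2.
  split; [revert H1|revert H2]; apply is_derive_ext; intros s; do 2 f_equal;
  unfold Cplus, Cmult, RtoC; simpl; f_equal; ring.
Qed.

Lemma is_derive_v (g : C -> C) (u v : R) (d : C) : cderiv g (u, v) d ->
  is_derive (fun s => Re (g (u, s))) v (- Im d) /\
  is_derive (fun s => Im (g (u, s))) v (Re d).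
Proof.
intros H; destruct (is_derive_line g (u, 0) Ci d v) as [H1 H2].
- replace ((u, 0) + RtoC v * Ci)%C with ((u, v) : C); auto.
  unfold Cplus, Cmult, RtoC, Ci; simpl; f_equal; ring.
- replace (Re (d * Ci)%C) with (- Im d) in H1 by (unfold Re, Im; simpl; ring).
  replace (Im (d * Ci)%C) with (Re d) in H2 by (unfold Re, Im; simpl; ring).
  split; [revert H1|revert H2]; apply is_derive_ext; intros s; do 2 f_equal;
  unfold Cplus, Cmult, RtoC, Ci; simpl; f_equal; ring.
Qed.

Lemma Derive_Re_linear (g g' : C -> C) (l m : C) (h : R -> R -> R) :
  (forall z, cderiv g z (g' z)) ->
  (forall x y, h x y = Re (g (RtoC x * l + RtoC y * m)%C)) ->
  forall x y,
  is_derive (fun t => h t y) x (Re (g' (RtoC x * l + RtoC y * m) * l)%C) /\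
  is_derive (fun t => h x t) y (Re (g' (RtoC x * l + RtoC y * m) * m)%C).
Proof.
intros Hg Hh x y; split.
- destruct (is_derive_line g (RtoC y * m) l (g' (RtoC x * l + RtoC y * m)%C) x) as [H _].
  + rewrite Cplus_comm; apply Hg.
  + revert H; apply is_derive_ext; intros t; now rewrite Hh, Cplus_comm.
- destruct (is_derive_line g (RtoC x * l) m (g' (RtoC x * l + RtoC y * m)%C) y) as [H _].
  + apply Hg.
  + revert H; apply is_derive_ext; intros t; now rewrite Hh.
Qed.

(** Each partial derivative is again the real part of a holomorphic function of the same linear
    argument, multiplied by [l] or [m]. Besides [1] and [Ci], general [l] and [m] serve the graph
    functions, which involve the inverse of the coordinate map. *)
Lemma smooth2_Re_holomorphic (g : C -> C) (l m : C) (h : R -> R -> R) :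
  holomorphic g -> (forall x y, h x y = Re (g (RtoC x * l + RtoC y * m)%C)) ->
  smooth2 h.
Proof.
intros Hg Hh s.
assert (K : exists gs, holomorphic gs /\
   forall x y, dpart s h x y = Re (gs (RtoC x * l + RtoC y * m)%C)).
{ induction s as [|b s [gs [Hgs E]]]; [now exists g|].
  destruct (holomorphic_derivative gs Hgs) as [g' [D Hg']].
  exists (fun z => g' z * (if b then l else m))%C; split.
  - intros z; destruct (Hg' z) as [d Hd]; eexists.
    apply cderiv_mult; [exact Hd|apply cderiv_const].
  - intros x y; destruct (Derive_Re_linear gs g' l m _ D E x y) as [H1 H2].
    destruct b; simpl; now apply is_derive_unique. }
destruct K as [gs [Hgs E]]; intros u v.
destruct (holomorphic_derivative gs Hgs) as [g' [D _]].
destruct (Derive_Re_linear gs g' l m _ D E u v) as [H1 H2].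
split; [|split]; [eexists; exact H1|eexists; exact H2|].
apply (continuous_ext (fun p : R * R => Re (gs (RtoC (fst p) * l + RtoC (snd p) * m)%C))).
{ intros p; now rewrite E. }
apply continuous_Re.
apply (continuous_comp (V := C_UniformSpace) (W := C_UniformSpace)
  (fun p : R * R => RtoC (fst p) * l + RtoC (snd p) * m)%C gs).
2: { now apply holomorphic_continuous. }
apply continuous_Cplus; apply continuous_Cmult; try apply continuous_const;
  (apply continuous_pair; simpl; [|apply continuous_const]);
  [apply continuous_fst|apply continuous_snd].
Qed.

(** * Conformal surfaces *)

(** The product of [fw] with itself is [(g11 - g22 - 2 * i * g12) / 4], and with its conjugate
    [(g11 + g22) / 4]. *)
Lemma conformal_metric (F : nat -> R -> R -> R) : conformal F ->
  forall u v, g11 F u v = g22 F u v /\ g12 F u v = 0 /\ 0 < g11 F u v.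
Proof.
intros HF u v; destruct (HF u v) as [H [_ P]].
assert (H1 := f_equal Re H). assert (H2 := f_equal Im H).
unfold lorC, conjv, Cconj, fw, Re, Im in H1, H2, P; simpl in H1, H2, P.
unfold g11, g12, g22, lorR, Fu, Fv.
repeat split; lra.
Qed.

Lemma conformal_spacelike F : conformal F -> spacelike F.
Proof.
intros HF u v; destruct (conformal_metric F HF u v) as [E [E0 P]].
split; auto; unfold gdet; rewrite <- E, E0; nra.
Qed.

(** The Lorentz square of the combination of the two tangent vectors is [(s ^ 2 + t ^ 2) * g11]. *)
Lemma conformal_independent F : conformal F -> forall u v s t : R,
  (forall k, (k < 4)%nat -> s * du (F k) u v + t * dv (F k) u v = 0) -> s = 0 /\ t = 0.
Proof.
intros HF u v s t H; destruct (conformal_metric F HF u v) as [E [E0 P]].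
assert (K : (s ^ 2 + t ^ 2) * g11 F u v = 0).
{ transitivity (s ^ 2 * g11 F u v + 2 * s * t * g12 F u v + t ^ 2 * g22 F u v);
    [rewrite E0, <- E; ring|].
  assert (H0 := H 0%nat); assert (H1 := H 1%nat); assert (H2 := H 2%nat); assert (H3 := H 3%nat).
  transitivity (- (s * du (F 0%nat) u v + t * dv (F 0%nat) u v) ^ 2
     + (s * du (F 1%nat) u v + t * dv (F 1%nat) u v) ^ 2
     + (s * du (F 2%nat) u v + t * dv (F 2%nat) u v) ^ 2
     + (s * du (F 3%nat) u v + t * dv (F 3%nat) u v) ^ 2).
  - unfold g11, g12, g22, lorR, Fu, Fv; ring.
  - rewrite H0, H1, H2, H3 by lia; ring. }
apply Rmult_integral in K; destruct K as [K|K]; [|lra].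
split; nra.
Qed.

(** In dimension two the weight [sqrt (gdet F u v)], equal to [g11], cancels the inverse metric
    inside the derivatives. *)
Lemma conformal_laplace_beltrami F h : conformal F -> forall u v,
  laplace_beltrami F h u v = / g11 F u v * lap h u v.
Proof.
intros HF u v; unfold laplace_beltrami, lap.
assert (S : forall u v, sqrt (gdet F u v) = g11 F u v).
{ intros u' v'; destruct (conformal_metric F HF u' v') as [E [E0 P]].
  unfold gdet; rewrite <- E, E0.
  replace (g11 F u' v' * g11 F u' v' - 0 ^ 2) with (Rsqr (g11 F u' v')) by (unfold Rsqr; ring).
  apply sqrt_Rsqr; lra. }
rewrite S; f_equal; f_equal; apply Derive_ext; intros t; rewrite S;
[destruct (conformal_metric F HF t v) as [E [E0 P]]
|destruct (conformal_metric F HF u t) as [E [E0 P]]];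
unfold gdet; rewrite <- E, E0; field; lra.
Qed.

(** * The surface *)

Lemma integrand_holomorphic (a : C -> C) (c : C) (k : nat) :
  holomorphic a -> (forall w, a w <> RtoC 0) ->
  holomorphic (fun z => integrand a c z k).
Proof.
intros Ha Ha0 z; destruct (Ha z) as [d Hd].
assert (Hi : cderiv (fun w => c / a w)%C z (c * (- (/ a z * / a z) * d))%C).
{ apply cderiv_scal, (cderiv_comp Cinv a); auto; now apply cderiv_Cinv. }
destruct k as [|[|[|k]]]; simpl; eexists.
- apply cderiv_plus; eassumption.
- apply cderiv_const.
- apply cderiv_const.
- apply cderiv_minus; eassumption.
Qed.

(** A holomorphic function whose real part is the coordinate [k] of the surface. *)
Definition surf_pot (a : C -> C) (c : C) (X0 : nat -> R) (k : nat) (z : C) : C :=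
  (RtoC (X0 k) + RtoC 2 * seg (fun z => integrand a c z k) 0 z)%C.

Lemma fsurf_Re a c X0 k u v : fsurf a c X0 k u v = Re (surf_pot a c X0 k (u, v)).
Proof.
unfold fsurf, surf_pot; rewrite re_plus, re_scal_l, re_RtoC; do 2 f_equal.
apply RInt_ext; intros t _; cbv beta.
assert (E : forall w : C, (w - 0)%C = w) by (intros; ring).
now rewrite !E, Cplus_0_l.
Qed.

Lemma cderiv_surf_pot a c X0 k : holomorphic a -> (forall w, a w <> RtoC 0) ->
  forall z, cderiv (surf_pot a c X0 k) z (RtoC 2 * integrand a c z k)%C.
Proof.
intros Ha Ha0 z; rewrite <- (Cplus_0_l (RtoC 2 * _)).
apply cderiv_plus; [apply cderiv_const|].
apply cderiv_scal, (primitive_exists (fun z => integrand a c z k)).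
now apply integrand_holomorphic.
Qed.

Lemma surf_pot_holomorphic a c X0 k : holomorphic a -> (forall w, a w <> RtoC 0) ->
  holomorphic (surf_pot a c X0 k).
Proof. intros Ha Ha0 z; eexists; now apply cderiv_surf_pot. Qed.

Lemma fsurf_du a c X0 k u v : holomorphic a -> (forall w, a w <> RtoC 0) ->
  du (fsurf a c X0 k) u v = 2 * Re (integrand a c (u, v) k).
Proof.
intros Ha Ha0; rewrite <- re_scal_l; apply is_derive_unique.
destruct (is_derive_u _ u v _ (cderiv_surf_pot a c X0 k Ha Ha0 (u, v))) as [H _].
revert H; apply is_derive_ext; intros t; now rewrite fsurf_Re.
Qed.

Lemma fsurf_dv a c X0 k u v : holomorphic a -> (forall w, a w <> RtoC 0) ->
  dv (fsurf a c X0 k) u v = - 2 * Im (integrand a c (u, v) k).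
Proof.
intros Ha Ha0.
replace (- 2 * Im (integrand a c (u, v) k)) with (- Im (RtoC 2 * integrand a c (u, v) k)%C)
  by (rewrite im_scal_l; ring).
apply is_derive_unique.
destruct (is_derive_v _ u v _ (cderiv_surf_pot a c X0 k Ha Ha0 (u, v))) as [H _].
revert H; apply is_derive_ext; intros t; now rewrite fsurf_Re.
Qed.

(** The first derivatives are twice the real part and minus twice the imaginary part of one
    holomorphic function, so the Cauchy-Riemann equations cancel the second derivatives. *)
Lemma fsurf_lap a c X0 k u v : holomorphic a -> (forall w, a w <> RtoC 0) ->
  lap (fsurf a c X0 k) u v = 0.
Proof.
intros Ha Ha0; unfold lap.
destruct (integrand_holomorphic a c k Ha Ha0 (u, v)) as [d Hd].
destruct (is_derive_u _ u v d Hd) as [H1 _]. destruct (is_derive_v _ u v d Hd) as [_ H2].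
replace (du (du (fsurf a c X0 k)) u v) with (2 * Re d).
2: { symmetry; apply is_derive_unique.
     apply (is_derive_ext (fun s => 2 * Re (integrand a c (s, v) k))).
     - intros t; now rewrite fsurf_du.
     - now apply is_derive_scal. }
replace (dv (dv (fsurf a c X0 k)) u v) with (- 2 * Re d).
2: { symmetry; apply is_derive_unique.
     apply (is_derive_ext (fun s => - 2 * Im (integrand a c (u, s) k))).
     - intros t; now rewrite fsurf_dv.
     - now apply is_derive_scal. }
ring.
Qed.

Lemma fsurf_fw a c X0 k u v : holomorphic a -> (forall w, a w <> RtoC 0) ->
  fw (fsurf a c X0) u v k = integrand a c (u, v) k.
Proof.
intros Ha Ha0; unfold fw; rewrite fsurf_du, fsurf_dv by auto.
destruct (integrand a c (u, v) k) as [x y]; simpl; f_equal; field.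
Qed.

Lemma integrand_Wv (a : C -> C) c z k : a z <> RtoC 0 ->
  integrand a c z k = Wv (a z) (c / a z)%C k.
Proof.
intros H; destruct k as [|[|[|k]]]; simpl; auto.
- field; auto.
- f_equal; field; auto.
Qed.

(** The outer coordinates contribute [-4ab] and the inner ones [4ab]. *)
Lemma lorC_Wv a b : lorC (Wv a b) (Wv a b) = RtoC 0.
Proof. 
unfold lorC; simpl.
replace (Ci * (1 - a * b) * (Ci * (1 - a * b)))%C with (- ((1 - a * b) * (1 - a * b)))%C.
- ring.
- replace (Ci * (1 - a * b) * (Ci * (1 - a * b)))%C with ((Ci * Ci) * ((1 - a * b) * (1 - a * b)))%C by ring.
  replace (Ci * Ci)%C with (RtoC (-1)); [ring|].
  unfold Ci, Cmult, RtoC; simpl; f_equal; ring.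
Qed.

Lemma lorC_Wv_conj a b :
  lorC (Wv a b) (conjv (Wv a b)) = RtoC (2 * Cmod (1 - a * Cconj b)%C ^ 2).
Proof.
rewrite RtoC_mult, Cmod2_conj.
destruct a as [a1 a2], b as [b1 b2].
unfold lorC, conjv, Cconj, Wv, Ci, Cmult, Cplus, Cminus, Cplus, Copp, RtoC; simpl.
f_equal; ring.
Qed.

(** * Logarithmic derivatives of a quotient of quadratic forms *)

(** With [p], [q] the real and imaginary parts of [a] along a coordinate line, this is the
    derivative of [ln lambda]; one real variable serves both directions. *)
Lemma is_derive_ln_quotient (p q : R -> R) (p1 q1 A B D t : R) :
  is_derive p t p1 -> is_derive q t q1 ->
  0 < A * p t ^ 2 + 2 * B * p t * q t + D * q t ^ 2 -> 0 < p t ^ 2 + q t ^ 2 ->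
  is_derive (fun s => ln (4 * (A * p s ^ 2 + 2 * B * p s * q s + D * q s ^ 2)
                            / (p s ^ 2 + q s ^ 2)) / 2) t
   (((A * p t + B * q t) / (A * p t ^ 2 + 2 * B * p t * q t + D * q t ^ 2)
      - p t / (p t ^ 2 + q t ^ 2)) * p1 +
    ((B * p t + D * q t) / (A * p t ^ 2 + 2 * B * p t * q t + D * q t ^ 2)
      - q t / (p t ^ 2 + q t ^ 2)) * q1).
Proof.
intros Hp Hq HS HN; auto_derive.
- repeat split; try (eexists; eassumption); try lra.
  apply Rdiv_lt_0_compat; lra.
- assert (E1 : Derive (fun x : R => p x) t = p1) by now apply is_derive_unique.
  assert (E2 : Derive (fun x : R => q x) t = q1) by now apply is_derive_unique.
  rewrite E1, E2.
  field; repeat split; lra.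
Qed.

Lemma is_derive2_ln_quotient (p q p1 q1 : R -> R) (p2 q2 A B D t : R) :
  is_derive p t (p1 t) -> is_derive q t (q1 t) -> is_derive p1 t p2 -> is_derive q1 t q2 ->
  let N := p t ^ 2 + q t ^ 2 in
  let S := A * p t ^ 2 + 2 * B * p t * q t + D * q t ^ 2 in
  let X := A * p t + B * q t in
  let Y := B * p t + D * q t in
  0 < S -> 0 < N ->
  is_derive (fun s => ((A * p s + B * q s) / (A * p s ^ 2 + 2 * B * p s * q s + D * q s ^ 2)
      - p s / (p s ^ 2 + q s ^ 2)) * p1 s +
    ((B * p s + D * q s) / (A * p s ^ 2 + 2 * B * p s * q s + D * q s ^ 2)
      - q s / (p s ^ 2 + q s ^ 2)) * q1 s) t
   ((A / S - 2 * X ^ 2 / S ^ 2 - 1 / N + 2 * p t ^ 2 / N ^ 2) * p1 t ^ 2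
    + 2 * (B / S - 2 * X * Y / S ^ 2 + 2 * p t * q t / N ^ 2) * p1 t * q1 t
    + (D / S - 2 * Y ^ 2 / S ^ 2 - 1 / N + 2 * q t ^ 2 / N ^ 2) * q1 t ^ 2
    + (X / S - p t / N) * p2 + (Y / S - q t / N) * q2).
Proof.
intros Hp Hq Hp1 Hq1 N S X Y HS HN; subst N S X Y; auto_derive.
- repeat split; try (eexists; eassumption); lra.
- assert (E1 : Derive (fun x : R => p x) t = p1 t) by now apply is_derive_unique.
  assert (E2 : Derive (fun x : R => q x) t = q1 t) by now apply is_derive_unique.
  assert (E3 : Derive (fun x : R => p1 x) t = p2) by now apply is_derive_unique.
  assert (E4 : Derive (fun x : R => q1 x) t = q2) by now apply is_derive_unique.
  rewrite E1, E2, E3, E4.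
  field; repeat split; lra.
Qed.

Lemma Cmod_sqr_ne_1 c : Re c ^ 2 + Im c ^ 2 <> 1 -> Cmod c <> 1.
Proof. intros H E; apply H; rewrite <- Cmod2_alt, E; ring. Qed.

(** Otherwise [z * Cconj (c / z)], whose modulus is that of [c], would equal 1. *)
Lemma one_minus_conj_neq_0 (z c : C) : z <> RtoC 0 -> Re c ^ 2 + Im c ^ 2 <> 1 ->
  (1 - z * Cconj (c / z))%C <> RtoC 0.
Proof.
intros Hz Hc E; apply (Cmod_sqr_ne_1 c Hc).
assert (P : 0 < Cmod z) by now apply Cmod_gt_0.
assert (E1 : (z * Cconj (c / z))%C = RtoC 1).
{ transitivity (1 - (1 - z * Cconj (c / z)))%C; [ring|rewrite E; ring]. }
apply (f_equal Cmod) in E1.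
rewrite Cmod_mult, Cmod_conj, Cmod_div, Cmod_1 in E1 by auto.
rewrite <- E1; field; lra.
Qed.

(** * Conformality, minimality and the graph property *)

Section Surface.
Variables (a : C -> C) (c : C) (X0 : nat -> R).
Hypotheses (Ha : holomorphic a) (Ha0 : forall w, a w <> RtoC 0)
  (Hc : Re c ^ 2 + Im c ^ 2 <> 1).
Let f := fsurf a c X0.

Lemma fsurf_fw_Wv k u v : fw f u v k = Wv (a (u, v)) (c / a (u, v))%C k.
Proof. unfold f; rewrite fsurf_fw by auto; now apply integrand_Wv. Qed.

Lemma fsurf_lorC_conj u v :
  lorC (fw f u v) (conjv (fw f u v)) =
  RtoC (2 * Cmod (1 - a (u, v) * Cconj (c / a (u, v)))%C ^ 2).
Proof.
rewrite <- lorC_Wv_conj; unfold lorC, conjv; now rewrite !fsurf_fw_Wv.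
Qed.

Lemma fsurf_conformal : conformal f.
Proof.
intros u v; rewrite fsurf_lorC_conj, re_RtoC, im_RtoC; split; [|split]; auto.
- rewrite <- (lorC_Wv (a (u, v)) (c / a (u, v))%C).
  unfold lorC; now rewrite !fsurf_fw_Wv.
- apply Rmult_lt_0_compat; [lra|].
  now apply pow_lt, Cmod_gt_0, one_minus_conj_neq_0.
Qed.

Lemma fsurf_minimal : minimal f.
Proof.
intros k u v _; rewrite conformal_laplace_beltrami by apply fsurf_conformal.
unfold f; rewrite fsurf_lap by auto; apply Rmult_0_r.
Qed.

Lemma fsurf_immersion : immersion f.
Proof.
split.
- intros k _; apply (smooth2_Re_holomorphic (surf_pot a c X0 k) 1 Ci).
  + now apply surf_pot_holomorphic.
  + intros x y; unfold f; rewrite fsurf_Re; do 2 f_equal.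
    unfold RtoC, Ci, Cmult, Cplus; simpl; f_equal; ring.
- apply conformal_independent, fsurf_conformal.
Qed.

Lemma fsurf_linear (k : nat) (d : C) u v : (forall z, integrand a c z k = d) ->
  f k u v - X0 k = 2 * Re (d * (u, v))%C.
Proof.
intros Hd; unfold f; rewrite fsurf_Re; unfold surf_pot.
rewrite (seg_FTC (fun w => d * w)%C).
- rewrite re_plus, re_RtoC, re_scal_l, Cmult_0_r.
  unfold Cminus; rewrite re_plus, re_opp, re_RtoC; ring.
- intros t _; rewrite Hd; apply cderiv_linear.
- intros t _; apply (continuous_ext (fun _ => d)); [intros; now rewrite Hd|apply continuous_const].
Qed.

Lemma fsurf_coordinates u v :
  f 1%nat u v - X0 1%nat = 2 * ((1 + Re c) * u - Im c * v) /\
  f 2%nat u v - X0 2%nat = 2 * (Im c * u + (Re c - 1) * v).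
Proof.
split.
- rewrite (fsurf_linear 1 (1 + c)%C) by reflexivity; simpl; unfold Re, Im; ring.
- rewrite (fsurf_linear 2 (Ci * (1 - c))%C) by reflexivity; simpl; unfold Re, Im; ring.
Qed.

(** Up to the factor 4, this is the determinant of the map from [(u, v)] to [(x, y)]. *)
Lemma coordinates_det : (Re c * Re c + Im c * Im c - 1) <> 0.
Proof. intros E; apply Hc; lra. Qed.

Lemma coordinates_bijective (x y : R) : exists! p : R * R,
  2 * ((1 + Re c) * fst p - Im c * snd p) = x /\
  2 * (Im c * fst p + (Re c - 1) * snd p) = y.
Proof.
assert (D := coordinates_det).
exists (((Re c - 1) * x + Im c * y) / (2 * (Re c * Re c + Im c * Im c - 1)),
        ((1 + Re c) * y - Im c * x) / (2 * (Re c * Re c + Im c * Im c - 1))); split.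
- simpl fst; simpl snd; split; field; auto.
- intros [u v] [E1 E2]; simpl in E1, E2; rewrite <- E1, <- E2; f_equal; field; auto.
Qed.

Lemma fsurf_graph : entire_graph_first_type f X0.
Proof.
assert (D := coordinates_det).
pose (d := 2 * (Re c * Re c + Im c * Im c - 1)).
pose (U x y := ((Re c - 1) * x + Im c * y) / d).
pose (V x y := ((1 + Re c) * y - Im c * x) / d).
assert (S : forall k, smooth2 (fun x y => f k (U x y) (V x y))).
(* The complex number [U + i V] is linear in [(x, y)]; the two pairs are its coefficients. *)
{ intros k; apply (smooth2_Re_holomorphic (surf_pot a c X0 k)
     (((Re c - 1) / d)%R, (- Im c / d)%R) ((Im c / d)%R, ((1 + Re c) / d)%R)).
  - now apply surf_pot_holomorphic.
  - intros x y; unfold f; rewrite fsurf_Re; do 2 f_equal.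
    unfold RtoC, Cmult, Cplus, U, V; simpl; f_equal; unfold d; field; auto. }
exists (fun x y => f 0%nat (U x y) (V x y)), (fun x y => f 3%nat (U x y) (V x y)).
split; [apply S|split; [apply S|split]].
- intros u v; destruct (fsurf_coordinates u v) as [E1 E2].
  exists (f 1%nat u v - X0 1%nat), (f 2%nat u v - X0 2%nat).
  replace (U _ _) with u by (unfold U, d; rewrite E1, E2; field; auto).
  replace (V _ _) with v by (unfold V, d; rewrite E1, E2; field; auto).
  repeat split; ring.
- intros x y; exists (U x y), (V x y).
  destruct (fsurf_coordinates (U x y) (V x y)) as [E1 E2].
  repeat split.
  + transitivity (X0 1%nat + (f 1%nat (U x y) (V x y) - X0 1%nat)); [ring|].
    rewrite E1; unfold U, V, d; field; auto.
  + transitivity (X0 2%nat + (f 2%nat (U x y) (V x y) - X0 2%nat)); [ring|].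
    rewrite E2; unfold U, V, d; field; auto.
Qed.

(** * Nonconstant [a]: fullness and curvature *)

Section Nonconstant.
Variable a' : C -> C.
Hypotheses (Da : forall z, cderiv a z (a' z)) (Ha' : holomorphic a')
  (Hnc : ~ exists a0 : C, forall w : C, a w = a0).

(** If [a'] vanished everywhere, integrating it from 0 would make [a] constant; continuity spreads
    one nonzero value to a disc. *)
Lemma nonconstant_derivative :
  exists z0 r, 0 < r /\ forall z, Cmod (z - z0) < r -> a' z <> RtoC 0.
Proof.
assert (Z : exists z0, a' z0 <> RtoC 0).
{ apply NNPP; intros H; apply Hnc; exists (a 0); intros w.
  assert (H0 : forall z, a' z = RtoC 0).
  { intros z; apply NNPP; intros Hz; apply H; now exists z. }
  assert (S1 := seg_FTC a (fun _ => RtoC 0) 0 w).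
  rewrite (seg_FTC (fun _ => RtoC 0)) in S1;
    [|intros; apply cderiv_const|intros; apply continuous_const].
  transitivity (a w - a 0 + a 0)%C; [ring|]; rewrite <- S1; [ring| |].
  - intros t _; assert (D := Da (0 + RtoC t * (w - 0))%C); now rewrite H0 in D.
  - intros; apply continuous_const. }
destruct Z as [z0 Hz0].
destruct (proj1 (continuous_C_eps a' z0) (holomorphic_continuous a' Ha' z0) (Cmod (a' z0)))
  as [r [Hr K]]; [now apply Cmod_gt_0|].
exists z0, r; split; auto; intros z Hz E; specialize (K z Hz).
rewrite E, Cmod_minus_sym in K.
replace (a' z0 - 0)%C with (a' z0) in K by ring; lra.
Qed.

(** Differentiating gives [(2 P a + k) a' = 0]; on the disc [a'] can be divided out, and a second
    differentiation leaves [2 P a' = 0]. *)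
Lemma quadratic_relation (P Q k : C) :
  (forall z, (P * (a z * a z) + k * a z + Q)%C = RtoC 0) ->
  P = RtoC 0 /\ k = RtoC 0 /\ Q = RtoC 0.
Proof.
intros H; destruct nonconstant_derivative as (z0 & r & Hr & Hz).
assert (H1 : forall z, ((RtoC 2 * P * a z + k) * a' z)%C = RtoC 0).
{ intros z; apply (cderiv_unique (fun _ => RtoC 0) z); [|apply cderiv_const].
  apply (cderiv_ext (fun z => P * (a z * a z) + (k * a z + Q))%C).
  { intros w; rewrite <- (H w); ring. }
  replace ((RtoC 2 * P * a z + k) * a' z)%C with
    (P * (a' z * a z + a z * a' z) + (k * a' z + 0))%C by ring.
  apply cderiv_plus; [apply cderiv_scal; now apply cderiv_mult|].
  apply cderiv_plus; [now apply cderiv_scal|apply cderiv_const]. }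
assert (Z0 : Cmod (z0 - z0) < r) by (replace (z0 - z0)%C with (RtoC 0) by ring; now rewrite Cmod_0).
assert (H2 : forall z, Cmod (z - z0) < r -> (RtoC 2 * P * a z + k)%C = RtoC 0).
{ intros z Hzr; apply NNPP; intros N; now apply (Cmult_neq_0 _ _ N (Hz z Hzr)). }
assert (H3 : (RtoC 2 * P * a' z0 + 0)%C = RtoC 0).
{ apply (cderiv_unique (fun _ => RtoC 0) z0); [|apply cderiv_const].
  apply (cderiv_ext_loc _ _ _ _ r Hr H2).
  apply cderiv_plus; [now apply cderiv_scal|apply cderiv_const]. }
assert (HP : P = RtoC 0).
{ apply NNPP; intros N; apply (Cmult_neq_0 (RtoC 2 * P) (a' z0)).
  - apply Cmult_neq_0; auto; intros E; apply RtoC_inj in E; lra.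
  - now apply Hz.
  - now rewrite Cplus_0_r in H3. }
subst P.
assert (Hk : k = RtoC 0) by (rewrite <- (H2 z0 Z0); ring).
split; [|split]; auto.
rewrite <- (H z0), Hk; ring.
Qed.

Lemma fsurf_not_in_hyperplane : c <> RtoC 0 -> not_in_hyperplane f.
Proof.
intros Hc0 n d [j [Hj Hnj]]; apply NNPP; intros H.
assert (E : forall u v, n 0%nat * f 0%nat u v + n 1%nat * f 1%nat u v
                + n 2%nat * f 2%nat u v + n 3%nat * f 3%nat u v = d).
{ intros u v; apply NNPP; intros N; apply H; now exists u, v. }
pose (G k z := (RtoC (n k) * integrand a c z k)%C).
(* The equation says that a holomorphic function has constant real part; both partial derivatives
   vanish, hence so does its complex derivative. *)
assert (Z : forall z, (G 0%nat z + G 1%nat z + G 2%nat z + G 3%nat z)%C = RtoC 0).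
{ intros [u v].
  pose (HH z := (RtoC (n 0%nat) * surf_pot a c X0 0 z + RtoC (n 1%nat) * surf_pot a c X0 1 z
     + RtoC (n 2%nat) * surf_pot a c X0 2 z + RtoC (n 3%nat) * surf_pot a c X0 3 z)%C).
  assert (DH : forall z, cderiv HH z (RtoC (n 0%nat) * (RtoC 2 * integrand a c z 0)
     + RtoC (n 1%nat) * (RtoC 2 * integrand a c z 1) + RtoC (n 2%nat) * (RtoC 2 * integrand a c z 2)
     + RtoC (n 3%nat) * (RtoC 2 * integrand a c z 3))%C).
  { intros z; repeat apply cderiv_plus; apply cderiv_scal; now apply cderiv_surf_pot. }
  assert (RH : forall u v, Re (HH (u, v)) = d).
  { intros u' v'; rewrite <- (E u' v'); unfold HH, f.
    now rewrite !re_plus, !re_scal_l, !fsurf_Re. }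
  destruct (is_derive_u HH u v _ (DH (u, v))) as [D1 _].
  destruct (is_derive_v HH u v _ (DH (u, v))) as [D2 _].
  apply is_derive_unique in D1. apply is_derive_unique in D2.
  rewrite (Derive_ext _ (fun _ => d)), Derive_const in D1 by (intros; apply RH).
  rewrite (Derive_ext _ (fun _ => d)), Derive_const in D2 by (intros; apply RH).
  rewrite !re_plus, !re_scal_l in D1. rewrite !im_plus, !im_scal_l in D2.
  unfold G; apply injective_projections.
  - change (Re (RtoC (n 0%nat) * integrand a c (u, v) 0 + RtoC (n 1%nat) * integrand a c (u, v) 1
      + RtoC (n 2%nat) * integrand a c (u, v) 2 + RtoC (n 3%nat) * integrand a c (u, v) 3)%C = 0).
    rewrite !re_plus, !re_scal_l; lra.
  - change (Im (RtoC (n 0%nat) * integrand a c (u, v) 0 + RtoC (n 1%nat) * integrand a c (u, v) 1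
      + RtoC (n 2%nat) * integrand a c (u, v) 2 + RtoC (n 3%nat) * integrand a c (u, v) 3)%C = 0).
    rewrite !im_plus, !im_scal_l; lra. }
(* Multiplying [Z] by [a] gives the quadratic equation. *)
destruct (quadratic_relation (RtoC (n 0%nat) + RtoC (n 3%nat)) ((RtoC (n 0%nat) - RtoC (n 3%nat)) * c)
  (RtoC (n 1%nat) * (1 + c) + RtoC (n 2%nat) * (Ci * (1 - c)))) as (P & K & Q).
{ intros z; rewrite <- (Cmult_0_l (a z)), <- (Z z); unfold G; simpl; field; apply Ha0. }
assert (Q' : (RtoC (n 0%nat) - RtoC (n 3%nat))%C = RtoC 0).
{ apply NNPP; intros N; now apply (Cmult_neq_0 _ _ N Hc0). }
rewrite <- RtoC_plus in P; rewrite <- RtoC_minus in Q'.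
apply RtoC_inj in P; apply RtoC_inj in Q'.
assert (K1 := f_equal Re K); assert (K2 := f_equal Im K).
simpl in K1, K2; fold (Re c) (Im c) in K1, K2.
(* Since the [n k] are real, [K] is a real 2 by 2 system, with determinant [1 - |c|^2]. *)
assert (L1 : n 1%nat * (1 + Re c) + n 2%nat * Im c = 0) by lra.
assert (L2 : n 1%nat * Im c + n 2%nat * (1 - Re c) = 0) by lra.
assert (D := coordinates_det).
assert (N1 : n 1%nat * (Re c * Re c + Im c * Im c - 1) = 0).
{ transitivity (Im c * (n 1%nat * Im c + n 2%nat * (1 - Re c))
    - (1 - Re c) * (n 1%nat * (1 + Re c) + n 2%nat * Im c)); [ring|rewrite L1, L2; ring]. }
assert (N2 : n 2%nat * (Re c * Re c + Im c * Im c - 1) = 0).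
{ transitivity (Im c * (n 1%nat * (1 + Re c) + n 2%nat * Im c)
    - (1 + Re c) * (n 1%nat * Im c + n 2%nat * (1 - Re c))); [ring|rewrite L1, L2; ring]. }
apply Rmult_integral in N1; apply Rmult_integral in N2.
apply Hnj; destruct j as [|[|[|[|j]]]]; [lra|tauto|tauto|lra|lia].
Qed.

(* [curv_num] and [metric_num] are the quadratic forms [T] and [S] above. *)
Definition curv_num (p q : R) : R :=
  (1 + Re c ^ 2 + Im c ^ 2) * (Re c * (p ^ 2 - q ^ 2) + 2 * Im c * p * q)
  - 2 * (Re c ^ 2 + Im c ^ 2) * (p ^ 2 + q ^ 2).

Definition metric_num (p q : R) : R :=
  (1 + Re c ^ 2 + Im c ^ 2 - 2 * Re c) * p ^ 2 + 2 * (- 2 * Im c) * p * q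
  + (1 + Re c ^ 2 + Im c ^ 2 + 2 * Re c) * q ^ 2.

(** Multiplying by [Cconj z] clears the denominator; [metric_num] is the squared modulus of
    [Cconj z - Cconj c * z]. *)
Lemma Cmod2_one_minus_conj (z : C) : z <> RtoC 0 ->
  Cmod (1 - z * Cconj (c / z))%C ^ 2 =
  metric_num (Re z) (Im z) / (Re z ^ 2 + Im z ^ 2).
Proof.
intros Hz.
assert (Hz' : Cconj z <> RtoC 0).
{ intros E; apply Hz; rewrite <- (Cconj_conj z), E.
  unfold Cconj, RtoC; simpl; f_equal; ring. }
replace (1 - z * Cconj (c / z))%C with ((Cconj z - Cconj c * z) / Cconj z)%C
  by (rewrite Cdiv_conj by auto; field; auto).
assert (P : 0 < Cmod z) by now apply Cmod_gt_0.
rewrite Cmod_div, Cmod_conj by auto.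
replace ((Cmod (Cconj z - Cconj c * z) / Cmod z) ^ 2)
  with (Cmod (Cconj z - Cconj c * z) ^ 2 / Cmod z ^ 2) by (field; lra).
rewrite !Cmod2_alt; unfold metric_num; f_equal; unfold Re, Im; simpl; ring.
Qed.

Lemma Re2_Im2_pos (z : C) : z <> RtoC 0 -> 0 < Re z ^ 2 + Im z ^ 2.
Proof. intros Hz; rewrite <- Cmod2_alt; now apply pow_lt, Cmod_gt_0. Qed.

Lemma metric_num_pos (z : C) : z <> RtoC 0 ->
  0 < metric_num (Re z) (Im z).
Proof.
intros Hz; assert (N := Re2_Im2_pos z Hz).
assert (P : 0 < Cmod (1 - z * Cconj (c / z))%C ^ 2)
  by now apply pow_lt, Cmod_gt_0, one_minus_conj_neq_0.
rewrite Cmod2_one_minus_conj in P by auto.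
apply Rmult_lt_compat_r with (r := Re z ^ 2 + Im z ^ 2) in P; auto.
rewrite Rmult_0_l in P; unfold Rdiv in P; rewrite Rmult_assoc, Rinv_l in P; lra.
Qed.

Lemma fsurf_lam2 u v : lam2 f u v =
  4 * metric_num (Re (a (u, v))) (Im (a (u, v)))
  / (Re (a (u, v)) ^ 2 + Im (a (u, v)) ^ 2).
Proof.
unfold lam2; rewrite fsurf_lorC_conj, re_RtoC, Cmod2_one_minus_conj by auto.
assert (N := Re2_Im2_pos _ (Ha0 (u, v))); field; lra.
Qed.

(** The second derivatives of [a] enter the [u] and [v] parts with opposite signs and cancel; the
    denominator [|a|^2] contributes nothing, since [ln |a|] is harmonic. *)
Lemma fsurf_lap_ln_lam2 u v :
  lap (fun u v => ln (lam2 f u v) / 2) u v =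
  4 * (Re (a' (u, v)) ^ 2 + Im (a' (u, v)) ^ 2) * curv_num (Re (a (u, v))) (Im (a (u, v)))
  / metric_num (Re (a (u, v))) (Im (a (u, v))) ^ 2.
Proof.
destruct (Ha' (u, v)) as [d Hd].
assert (N := Re2_Im2_pos _ (Ha0 (u, v))). assert (S := metric_num_pos _ (Ha0 (u, v))).
assert (DU : forall s t, is_derive (fun r => Re (a (r, t))) s (Re (a' (s, t))) /\
                         is_derive (fun r => Im (a (r, t))) s (Im (a' (s, t))))
  by (intros; now apply is_derive_u).
assert (DV : forall s t, is_derive (fun r => Re (a (s, r))) t (- Im (a' (s, t))) /\
                         is_derive (fun r => Im (a (s, r))) t (Re (a' (s, t))))
  by (intros; now apply is_derive_v).
destruct (is_derive_u a' u v d Hd) as [DU1 DU2].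
destruct (is_derive_v a' u v d Hd) as [DV1 DV2].
assert (DV3 := is_derive_opp (V := R_NormedModule) _ _ _ DV2).
assert (U := is_derive2_ln_quotient (fun s => Re (a (s, v))) (fun s => Im (a (s, v)))
  (fun s => Re (a' (s, v))) (fun s => Im (a' (s, v))) _ _
  (1 + Re c ^ 2 + Im c ^ 2 - 2 * Re c) (- 2 * Im c) (1 + Re c ^ 2 + Im c ^ 2 + 2 * Re c)
  u (proj1 (DU u v)) (proj2 (DU u v)) DU1 DU2 S N).
assert (V := is_derive2_ln_quotient (fun s => Re (a (u, s))) (fun s => Im (a (u, s)))
  (fun s => - Im (a' (u, s))) (fun s => Re (a' (u, s))) _ _
  (1 + Re c ^ 2 + Im c ^ 2 - 2 * Re c) (- 2 * Im c) (1 + Re c ^ 2 + Im c ^ 2 + 2 * Re c)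
  v (proj1 (DV u v)) (proj2 (DV u v)) DV3 DV1 S N).
cbv beta zeta in U, V.
unfold lap.
eapply eq_trans; [apply f_equal2; apply is_derive_unique|].
- eapply is_derive_ext; [|exact U]; intros s; symmetry; apply is_derive_unique.
  eapply is_derive_ext; [intros r; symmetry; now rewrite fsurf_lam2|].
  apply is_derive_ln_quotient; try apply DU.
  + now apply (metric_num_pos (a (s, v))).
  + now apply (Re2_Im2_pos (a (s, v))).
- eapply is_derive_ext; [|exact V]; intros s; symmetry; apply is_derive_unique.
  eapply is_derive_ext; [intros r; symmetry; now rewrite fsurf_lam2|].
  apply is_derive_ln_quotient; try apply DV.
  + now apply (metric_num_pos (a (u, s))).
  + now apply (Re2_Im2_pos (a (u, s))).
- change (@opp R_NormedModule (Re d)) with (- Re d).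
  unfold curv_num, metric_num in *; field; split; lra.
Qed.

(* The hypotheses say that the gradient of [curv_num] vanishes at [(p, q)]; its
   determinant is a multiple of [|c|^2 (1 - |c|^2)^2]. *)
Lemma curv_num_critical (p q : R) : c <> RtoC 0 ->
  (1 + Re c ^ 2 + Im c ^ 2) * (Re c * p + Im c * q) - 2 * (Re c ^ 2 + Im c ^ 2) * p = 0 ->
  (1 + Re c ^ 2 + Im c ^ 2) * (Im c * p - Re c * q) - 2 * (Re c ^ 2 + Im c ^ 2) * q = 0 ->
  p = 0 /\ q = 0.
Proof.
intros Hc0 E1 E2.
assert (M := Re2_Im2_pos c Hc0).
set (m := Re c ^ 2 + Im c ^ 2) in *.
assert (K : m * (1 - m) ^ 2 <> 0).
{ apply Rmult_integral_contrapositive_currified; [lra|apply pow_nonzero; lra]. }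
(* The sum [1 + Re c ^ 2 + Im c ^ 2] associates to the left, so it does not contain [m] and is
   rewritten separately. *)
assert (E : forall x y, (1 + Re c ^ 2 + Im c ^ 2) * (Re c * x + Im c * y) - 2 * m * x =
   (1 + m) * (Re c * x + Im c * y) - 2 * m * x) by (intros; unfold m; ring).
rewrite E in E1; clear E.
replace (1 + Re c ^ 2 + Im c ^ 2) with (1 + m) in E2 by (unfold m; ring).
(* Cramer's rule: the multipliers are the entries of minus the adjugate matrix, here and for [q]. *)
assert (P : m * (1 - m) ^ 2 * p = 0).
{ transitivity (((1 + m) * Re c + 2 * m) * ((1 + m) * (Re c * p + Im c * q) - 2 * m * p)
    + (1 + m) * Im c * ((1 + m) * (Im c * p - Re c * q) - 2 * m * q)).
  - transitivity ((1 + m) ^ 2 * (Re c ^ 2 + Im c ^ 2) * p - 4 * m ^ 2 * p); [unfold m; ring|ring].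
  - rewrite E1, E2; ring. }
assert (Q : m * (1 - m) ^ 2 * q = 0).
{ transitivity ((1 + m) * Im c * ((1 + m) * (Re c * p + Im c * q) - 2 * m * p)
    - ((1 + m) * Re c - 2 * m) * ((1 + m) * (Im c * p - Re c * q) - 2 * m * q)).
  - transitivity ((1 + m) ^ 2 * (Re c ^ 2 + Im c ^ 2) * q - 4 * m ^ 2 * q); [unfold m; ring|ring].
  - rewrite E1, E2; ring. }
apply Rmult_integral in P; apply Rmult_integral in Q; tauto.
Qed.

Lemma fsurf_curved : c <> RtoC 0 -> exists u v, gauss_curv f u v <> 0.
Proof.
intros Hc0; apply NNPP; intros H.
destruct nonconstant_derivative as ([u0 v0] & r & Hr & Hz).
assert (T : forall u v, Cmod ((u, v) - (u0, v0))%C < r ->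
   curv_num (Re (a (u, v))) (Im (a (u, v))) = 0).
{ intros u v Hw.
  assert (G : gauss_curv f u v = 0).
  { apply NNPP; intros G; apply H; now exists u, v. }
  unfold gauss_curv in G; rewrite fsurf_lap_ln_lam2, fsurf_lam2 in G.
  assert (N := Re2_Im2_pos _ (Ha0 (u, v))). assert (S := metric_num_pos _ (Ha0 (u, v))).
  assert (N' := Re2_Im2_pos _ (Hz _ Hw)).
  set (x := curv_num _ _) in *.
  match type of S with 0 < ?X => set (s := X) in * end.
  match type of N with 0 < ?X => set (n := X) in * end.
  match type of N' with 0 < ?X => set (n' := X) in * end.
  (* The curvature is a negative multiple of [curv_num] wherever [a'] does not vanish. *)
  assert (E : - / (4 * s / n) * (4 * n' * x / s ^ 2) = - (n * n' / s ^ 3) * x)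
    by (field; lra).
  rewrite E in G; apply Rmult_integral in G; destruct G as [G|G]; auto.
  assert (0 < n * n' / s ^ 3).
  { apply Rdiv_lt_0_compat; [now apply Rmult_lt_0_compat|now apply pow_lt]. }
  lra. }
(* The chain rule for [curv_num] along a curve; the brackets are half of its partial derivatives. *)
assert (D : forall (p q : R -> R) (t p1 q1 : R), is_derive p t p1 -> is_derive q t q1 ->
  locally t (fun s => curv_num (p s) (q s) = 0) ->
  2 * ((1 + Re c ^ 2 + Im c ^ 2) * (Re c * p t + Im c * q t) - 2 * (Re c ^ 2 + Im c ^ 2) * p t) * p1
  + 2 * ((1 + Re c ^ 2 + Im c ^ 2) * (Im c * p t - Re c * q t) - 2 * (Re c ^ 2 + Im c ^ 2) * q t) * q1 = 0).
{ intros p q t p1 q1 Hp Hq L.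
  assert (Z : Derive (fun s => curv_num (p s) (q s)) t = 0)
    by exact (eq_trans (Derive_ext_loc _ (fun _ => 0) t L) (Derive_const 0 t)).
  etransitivity; [|exact Z]; symmetry; apply is_derive_unique; unfold curv_num; auto_derive.
  - repeat split; eexists; eassumption.
  - assert (E1 : Derive (fun x : R => p x) t = p1) by now apply is_derive_unique.
    assert (E2 : Derive (fun x : R => q x) t = q1) by now apply is_derive_unique.
    rewrite E1, E2; ring. }
destruct (is_derive_u a u0 v0 _ (Da (u0, v0))) as [U1 U2].
destruct (is_derive_v a u0 v0 _ (Da (u0, v0))) as [V1 V2].
assert (Z1 := D _ _ _ _ _ U1 U2). assert (Z2 := D _ _ _ _ _ V1 V2). clear D.
cbv beta in Z1, Z2.
assert (Z0 : 0 < Re (a' (u0, v0)) ^ 2 + Im (a' (u0, v0)) ^ 2).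
{ apply Re2_Im2_pos, Hz; unfold Cminus; rewrite Cplus_opp_r; now rewrite Cmod_0. }
match type of Z1 with _ -> 2 * ?X * _ + 2 * ?Y * _ = 0 => set (P := X) in *; set (Q := Y) in * end.
assert (F1 : 2 * P * Re (a' (u0, v0)) + 2 * Q * Im (a' (u0, v0)) = 0).
{ apply Z1; exists (mkposreal r Hr); intros s Hs; apply T.
  eapply Rle_lt_trans; [apply Cmod_le_sum|]; simpl.
  change (Rabs (s - u0) < r) in Hs. rewrite Rplus_opp_r, Rabs_R0; unfold Rminus in Hs; lra. }
assert (F2 : 2 * P * - Im (a' (u0, v0)) + 2 * Q * Re (a' (u0, v0)) = 0).
{ apply Z2; exists (mkposreal r Hr); intros s Hs; apply T.
  eapply Rle_lt_trans; [apply Cmod_le_sum|]; simpl.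
  change (Rabs (s - v0) < r) in Hs. rewrite Rplus_opp_r, Rabs_R0; unfold Rminus in Hs; lra. }
set (x := Re (a' (u0, v0))) in *; set (y := Im (a' (u0, v0))) in *.
(* By the Cauchy-Riemann equations the coefficient rows of [F1] and [F2] are orthogonal, of squared
   length proportional to [|a'|^2], so both half-derivatives vanish. *)
assert (HP : P * (x ^ 2 + y ^ 2) = 0).
{ transitivity (((2 * P * x + 2 * Q * y) * x - (2 * P * - y + 2 * Q * x) * y) / 2);
    [field|rewrite F1, F2; field]. }
assert (HQ : Q * (x ^ 2 + y ^ 2) = 0).
{ transitivity (((2 * P * x + 2 * Q * y) * y + (2 * P * - y + 2 * Q * x) * x) / 2);
    [field|rewrite F1, F2; field]. }
apply Rmult_integral in HP; apply Rmult_integral in HQ.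
destruct (curv_num_critical (Re (a (u0, v0))) (Im (a (u0, v0))) Hc0) as [R1 R2].
- destruct HP; [assumption|lra].
- destruct HQ; [assumption|lra].
- generalize (Re2_Im2_pos _ (Ha0 (u0, v0))); rewrite R1, R2; lra.
Qed.
End Nonconstant.
End Surface.

Theorem theorem4p5 (a : C -> C) (c : C) (X0 : nat -> R)
  (Ha : entire a) (Ha0 : forall w : C, a w <> RtoC 0)
  (Hc0 : c <> RtoC 0) (Hc1 : c <> RtoC 1) (Hcm1 : c <> RtoC (-1))
  (Hc : Re c ^ 2 + Im c ^ 2 <> 1) :
  let f := fsurf a c X0 in
  let alpha := Re c in
  let beta := Im c in
  (* conformal minimal spacelike immersion, with f_w = W(a, c/a) *)
  (immersion f /\ conformal f /\ minimal f /\ spacelike f /\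
   (forall (k : nat) (u v : R), (k < 4)%nat ->
      fw f u v k = Wv (a (u, v)) (c / a (u, v))%C k)) /\
  (* the coordinates x, y and the linear bijection (u,v) |-> (x,y) *)
  (forall u v : R,
      f 1%nat u v - X0 1%nat = 2 * ((1 + alpha) * u - beta * v) /\
      f 2%nat u v - X0 2%nat = 2 * (beta * u + (alpha - 1) * v)) /\
  (forall x y : R, exists! p : R * R,
      2 * ((1 + alpha) * fst p - beta * snd p) = x /\
      2 * (beta * fst p + (alpha - 1) * snd p) = y) /\
  (* entire graph of first type *)
  entire_graph_first_type f X0 /\
  (* non-constant a: nonzero Gauss curvature somewhere, full (no hyperplane) *)
  ((~ exists a0 : C, forall w : C, a w = a0) ->
     (exists u v : R, gauss_curv f u v <> 0) /\ not_in_hyperplane f).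
Proof.
assert (Hol : holomorphic a).
{ intros z; destruct (Ha z) as [l Hl]; exists l; now apply is_derive_cderiv. }
destruct (holomorphic_derivative a Hol) as [a' [Da Ha']].
intros f alpha beta; split; [|split; [|split; [|split]]].
- split; [|split; [|split; [|split]]].
  + now apply fsurf_immersion.
  + now apply fsurf_conformal.
  + now apply fsurf_minimal.
  + now apply conformal_spacelike, fsurf_conformal.
  + intros k u v _; now apply fsurf_fw_Wv.
- intros u v; apply (fsurf_coordinates a c X0 u v).
- now apply coordinates_bijective.
- now apply fsurf_graph.
- intros Hnc; split.
  + now apply fsurf_curved with a'.
  + now apply fsurf_not_in_hyperplane with a'.
Qed.
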